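(* Let $-\infty<a<b<+\infty$, $0<\alpha<1$, $0\le\beta\le1$, $\gamma=\alpha+\beta-\alpha\beta$, and let $c,d,e_k\in\mathbb{R}$ with $d\neq0$ and $c+d\neq0$. Assume: (1) $f:(a,b]\times\mathbb{R}\to\mathbb{R}$ is a function such that $f(\cdot,z(\cdot))\in C_{1-\gamma}^{\beta(1-\alpha)}[a,b]$ for any $z\in C_{1-\gamma}[a,b]$, and there exists a constant $L>0$ such that $$|f(t,z)-f(t,w)|\le L|z-w|\quad\text{for all }t\in(a,b],\ z,w\in\mathbb{R};$$ (2) the following inequality holds: $$\mathcal W:=\left[\left|\frac{1}{1+\frac cd}\right|\frac{1}{\Gamma(\gamma)}+\frac{\Gamma(\alpha+1)}{\Gamma(\gamma+\alpha)}\right]\frac{\Gamma(\gamma)(b-a)^{\alpha}}{\Gamma(\alpha+1)}\,L<1;$$ (3) the following inequality holds: $$\left|\frac{1}{1+\frac cd}\right|\frac{(b-a)^{\alpha}}{\Gamma(\gamma)}\,\frac{\Gamma(\gamma)}{\Gamma(\alpha+1)}\,L<1.$$ Then the Hilfer boundary value problem $$D_{a^+}^{\alpha,\beta}z(t)=f(t,z(t)),\quad t\in(a,b],\qquad I_{a^+}^{1-\gamma}\big[c\,z(a^+)+d\,z(b^-)\big]=e_k,$$ has at least one solution $z$ in $C_{1-\gamma}^{\gamma}[a,b]\subset C_{1-\gamma}^{\alpha,\beta}[a,b]$.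
   Context: Notation. For $\mu>0$, $I_{a^+}^{\mu}g(t)=\frac1{\Gamma(\mu)}\int_a^t(t-s)^{\mu-1}g(s)\,ds$ is the left-sided Riemann–Liouville fractional integral, and $I_{a^+}^0$ is the identity. For $0\le\mu\le1$, $D_{a^+}^{\mu}g=\frac{d}{dt}I_{a^+}^{1-\mu}g$ is the Riemann–Liouville derivative. For $0<\alpha<1$, $0\le\beta\le1$, the Hilfer derivative of order $\alpha$ and type $\beta$ is $D_{a^+}^{\alpha,\beta}g=I_{a^+}^{\beta(1-\alpha)}\frac{d}{dt}I_{a^+}^{(1-\beta)(1-\alpha)}g$. With $\gamma=\alpha+\beta-\alpha\beta$ one has $(1-\beta)(1-\alpha)=1-\gamma$. Spaces. $C_{1-\gamma}[a,b]$ is the set of $g:(a,b]\to\mathbb{R}$ such that $(t-a)^{1-\gamma}g(t)$ is continuous on $[a,b]$ (i.e. extends continuously to $t=a$), with norm $\|g\|_{C_{1-\gamma}}=\sup_{t\in(a,b]}|(t-a)^{1-\gamma}g(t)|$. For $0\le\mu\le1$, $C_{1-\gamma}^{\mu}[a,b]=\{g\in C_{1-\gamma}[a,b]: D_{a^+}^{\mu}g\in C_{1-\gamma}[a,b]\}$ (used with $\mu=\gamma$ and $\mu=\beta(1-\alpha)$). $C_{1-\gamma}^{\alpha,\beta}[a,b]=\{g\in C_{1-\gamma}[a,b]: D_{a^+}^{\alpha,\beta}g\in C_{1-\gamma}[a,b]\}$. The boundary condition $I_{a^+}^{1-\gamma}[c\,z(a^+)+d\,z(b^-)]=e_k$ means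 $c\lim_{t\to a^+}I_{a^+}^{1-\gamma}z(t)+d\lim_{t\to b^-}I_{a^+}^{1-\gamma}z(t)=e_k$. Here $e_k$ is just a fixed real number. *)

(* Defs.v *)
From HB Require Import structures.
From mathcomp Require Import all_boot all_order all_algebra.
From mathcomp Require Import all_classical all_reals all_analysis.

Set Implicit Arguments.
Unset Strict Implicit.
Unset Printing Implicit Defensive.

Import Order.TTheory GRing.Theory Num.Theory.
Import numFieldNormedType.Exports.

Local Open Scope classical_set_scope.
Local Open Scope ring_scope.

(* A function on (a, b] is represented by a total function [R -> R]; every
   notion below depends only on its values on `]a, b]. *)

Definition Gamma {R : realType} (x : R) : R :=
  \int[@lebesgue_measure R]_(t in `]0, +oo[) (t `^ (x - 1) * expR (- t)).

Definition RL_integral {R : realType} (a mu : R) (g : R -> R) (t : R) : R :=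
  if mu == 0 then g t
  else (Gamma mu)^-1 *
    \int[@lebesgue_measure R]_(s in `]a, t[) ((t - s) `^ (mu - 1) * g s).

(* [Rintegral] is 0 for some non-integrable functions, so that the existence of
   the integral has to be required separately. *)
Definition RL_integrable {R : realType} (a b mu : R) (g : R -> R) : Prop :=
  mu != 0 -> forall t, t \in `]a, b] ->
    (@lebesgue_measure R).-integrable `]a, t[
      (fun s => ((t - s) `^ (mu - 1) * g s)%:E).

(* The difference quotient is restricted to (a, b]: the derivative is two-sided
   on (a, b) and left-sided at b. *)
Definition deriv_oc {R : realType} (a b : R) (F : R -> R) (t : R) : R :=
  lim ((F s - F t) / (s - t) @[s --> within `]a, b] (t^')]).

Definition derivable_oc {R : realType} (a b : R) (F : R -> R) : Prop :=
  forall t, t \in `]a, b] ->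
    cvg ((F s - F t) / (s - t) @[s --> within `]a, b] (t^')]).

Definition RL_derivative {R : realType} (a b mu : R) (g : R -> R) : R -> R :=
  deriv_oc a b (RL_integral a (1 - mu) g).

Definition Hilfer_derivative {R : realType} (a b alpha beta : R)
    (g : R -> R) : R -> R :=
  RL_integral a (beta * (1 - alpha))
    (deriv_oc a b (RL_integral a ((1 - beta) * (1 - alpha)) g)).

(* The weighted space $C_w[a,b]$, used with $w = 1 - \gamma$. *)
Definition wC {R : realType} (a b w : R) : set (R -> R) :=
  [set g | {within `]a, b], continuous (fun t => (t - a) `^ w * g t)} /\
           cvg ((t - a) `^ w * g t @[t --> a^'+])].

(* $C_w^{\mu}[a,b]$. *)
Definition wC_RL {R : realType} (a b w mu : R) : set (R -> R) :=
  [set g | [/\ wC a b w g,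
               derivable_oc a b (RL_integral a (1 - mu) g) &
               wC a b w (RL_derivative a b mu g)]].

(* $C_w^{\alpha,\beta}[a,b]$. *)
Definition wC_Hilfer {R : realType} (a b w alpha beta : R) : set (R -> R) :=
  [set g | [/\ wC a b w g,
               derivable_oc a b (RL_integral a ((1 - beta) * (1 - alpha)) g),
               RL_integrable a b (beta * (1 - alpha))
                 (deriv_oc a b
                    (RL_integral a ((1 - beta) * (1 - alpha)) g)) &
               wC a b w (Hilfer_derivative a b alpha beta g)]].

(* $I_{a^+}^{1-\gamma}[c\,z(a^+) + d\,z(b^-)] = e$; both one-sided limits are
   required to exist. *)
Definition RL_boundary_condition {R : realType} (a b gamma c d e : R)
    (z : R -> R) : Prop :=
  exists la lb : R,
    [/\ RL_integral a (1 - gamma) z t @[t --> a^'+] --> la,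
        RL_integral a (1 - gamma) z t @[t --> b^'-] --> lb &
        c * la + d * lb = e].

(* Main.v *)
(** Since [(1 - beta) (1 - alpha) = 1 - gamma], the Hilfer derivative is
    [I^n D^gamma] with [n = beta (1 - alpha)], and integrating the problem gives
    the fixed point equation [z = T z],
    [T z = K z * (t - a)^(gamma - 1) / Gamma gamma + I^alpha (f (., z))], where
    [K z = ek / (c + d) - d / (c + d) * I^(1 - gamma + alpha) (f (., z)) (b)].
    By the beta integral, [T] is a contraction of ratio exactly [W] for the
    norm of [C_(1 - gamma)].  At a fixed point, [I^(1 - gamma) z] is the constant
    [K z] plus [I^(1 - n) F] with [F = f (., z)], so [D^gamma z = D^n F]; and
    [I^n D^n F = F] because [I^(1 - n) F] vanishes at [a]. *)

Require Import Defs.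
From HB Require Import structures.
From mathcomp Require Import all_boot all_order all_algebra.
From mathcomp Require Import all_classical all_reals all_analysis.
From mathcomp Require Import measurable_realfun interval_inference ring lra.
Set Implicit Arguments.
Unset Strict Implicit.
Unset Printing Implicit Defensive.
Import Order.TTheory GRing.Theory Num.Theory.
Import numFieldNormedType.Exports.
Local Open Scope classical_set_scope.
Local Open Scope ring_scope.

(** The integrands are singular at both ends, like (t - s)^(m - 1) at t and (s - a)^(g - 1) at a,
    over a domain that moves with t. Writing each function as the kernel [rlk g (s - a)] times a
    bounded continuous factor on the whole line confines both singularities to kernels whose
    convolution is known in closed form. That one identity supplies integrability, the majorants for
    Fubini and for continuity in t, and the constants of the contraction. As the factor extends past
    b, the endpoint b can be treated as an interior point when differentiating. The coefficient of
    (t - a)^(gamma - 1) is the freedom that the differential equation leaves; I^(1 - gamma) turns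
    that power into a constant, so the boundary condition fixes it. The two summands of W come from
    the two terms of T: the variation of the coefficient, and the largest ratio on (a, b] of the
    kernels of orders alpha + gamma and gamma. The Banach iteration is run on the continuous
    factors, so that its limit lies in the space by construction. *)

(** * Affine change of variables on the line *)

(** Lebesgue measure equals k times its pushforward under x -> r + k x, because the two agree on
    half-open intervals. Arguing on measures requires only measurability of the integrand. *)
Lemma ge0_integral_affine (R : realType) (k r : R) (f : R -> \bar R) :
  0 < k -> measurable_fun [set: R] f -> (forall x, (0 <= f x)%E) ->
  (\int[@lebesgue_measure R]_x f x =
   k%:E * \int[@lebesgue_measure R]_x f (r + k * x)%R)%E.
Proof.
move=> k0 mf f0; pose phi (x : measurableTypeR R) : measurableTypeR R := r + k * x.
have mphi : measurable_fun [set: measurableTypeR R] phi.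
  by apply: measurable_funD => //; exact: measurable_funM.
pose knn : {nonneg R} := NngNum (ltW k0).
pose pf : {measure set (measurableTypeR R) -> \bar R} :=
  measure_function_pushforward__canonical__measure_function_Measure
    (@lebesgue_measure R) mphi.
pose nu := mscale knn pf.
have nuE A : measurable A -> lebesgue_measure A = nu A.
  apply: lebesgue_measure_unique => _ [[u v]] _ <-.
  have E : phi @^-1` `]u, v] = `](u - r) / k, (v - r) / k]%classic.
    apply/seteqP; split => x /=; rewrite !in_itv/= /phi ltr_pdivrMr// ler_pdivlMr//.
      by move=> /andP[h1 h2]; apply/andP; split; lra.
    by move=> /andP[h1 h2]; apply/andP; split; lra.
  transitivity (k%:E * lebesgue_measure `]((u - r) / k)%R, ((v - r) / k)%R]%classic)%E;
    last by rewrite -E.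
  rewrite !lebesgue_measure_itv/= !lte_fin ltr_pM2r ?invr_gt0// ltrD2r.
  case: ifPn => uv; last by rewrite mule0.
  by rewrite -!EFinD -EFinM; congr EFin; field; rewrite gt_eqF.
transitivity (\int[nu]_x f x)%E.
  by apply: eq_measure_integral => A mA _; exact: nuE.
rewrite /nu ge0_integral_mscale//=; congr (_ * _)%E.
by rewrite ge0_integral_pushforward// => y _; exact: f0.
Qed.

Lemma integral_affine (R : realType) (k r : R) (f : R -> \bar R) :
  0 < k -> measurable_fun [set: R] f ->
  (\int[@lebesgue_measure R]_x f x =
   k%:E * \int[@lebesgue_measure R]_x f (r + k * x)%R)%E.
Proof.
move=> k0 mf; rewrite integralE [in RHS]integralE.
rewrite (@ge0_integral_affine _ k r (f^\+)%E)//; last exact: measurable_funepos.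
rewrite (@ge0_integral_affine _ k r (f^\-)%E)//; last exact: measurable_funeneg.
have kE : (0 < k%:E)%E by rewrite lte_fin.
have kB (x y : \bar R) : (k%:E * x - k%:E * y = k%:E * (x - y))%E.
  move: x y => [x| |] [y| |]; first (by rewrite muleBr);
  by rewrite /= ?(gt0_muley kE) ?(gt0_muleNy kE)//= ?(gt0_muley kE) ?(gt0_muleNy kE).
by rewrite kB; congr (_ * (_ - _))%E; apply: eq_integral => x _;
  rewrite ?funeposE ?funenegE.
Qed.

Lemma Rintegral_affine (R : realType) (k r : R) (f : R -> R) :
  0 < k -> measurable_fun [set: R] f ->
  \int[@lebesgue_measure R]_x f x =
  k * \int[@lebesgue_measure R]_x f (r + k * x).
Proof.
move=> k0 mf; rewrite /Rintegral (@integral_affine _ k r)//; last first.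
  exact/measurable_EFinP.
(* If the integral is infinite, [fine] sends both sides to 0. *)
move: (integral _ _ _) => [x| |] //=.
  by rewrite gt0_muley ?lte_fin//= mulr0.
by rewrite gt0_muleNy ?lte_fin//= mulr0.
Qed.

(** * Truncated powers and the Gamma integral *)

Section truncated_power.
Context {R : realType}.
Implicit Types m n x y t r : R.
Local Notation mu := (@lebesgue_measure R).

(* Truncating at 0 turns the integrals over ]a, t[ and ]0, +oo[ into integrals
   over the line. *)
Definition tpow m x : R := if 0 < x then x `^ (m - 1) else 0.

Lemma tpow_ge0 m x : 0 <= tpow m x.
Proof. by rewrite /tpow; case: ifP => // _; exact: powR_ge0. Qed.

Lemma tpow_gt0 m x : 0 < x -> 0 < tpow m x.
Proof. by move=> x0; rewrite /tpow x0 powR_gt0. Qed.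

Lemma tpow_le0 m x : x <= 0 -> tpow m x = 0.
Proof. by rewrite /tpow leNgt => /negbTE ->. Qed.

Lemma measurable_tpow m : measurable_fun [set: R] (tpow m).
Proof.
by apply: measurable_fun_ifT => //; exact: measurable_fun_ltr.
Qed.

Lemma tpowM m x y : 0 < x -> tpow m (x * y) = x `^ (m - 1) * tpow m y.
Proof.
move=> x0; rewrite /tpow pmulr_rgt0//; case: ifPn => y0; last by rewrite mulr0.
by rewrite powRM// ltW.
Qed.

Lemma integral_tpowE m (f : R -> R) :
  (\int[mu]_x (tpow m x * f x)%:E = \int[mu]_(x in `]0%R, +oo[) (x `^ (m - 1) * f x)%:E)%E.
Proof.
rewrite [RHS]integral_mkcond; apply: eq_integral => x _.
rewrite patchE mem_setE in_itv/= andbT /tpow; case: ifP => //.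
by rewrite mul0r.
Qed.

(** Exhaustion by the segments [F n], which avoid the singularity at 0: on each the primitive x^m /
    m bounds the integral by 1 / m. *)
Lemma integral_tpow_itv01_lty m : 0 < m ->
  (\int[mu]_(x in `]0%R, 1%R]) (tpow m x)%:E < +oo)%E.
Proof.
move=> m0; pose F (n : nat) : set R := `[n.+1%:R^-1, 1]%classic.
have FE : \bigcup_n F n = `]0, 1]%classic.
  apply/seteqP; split => [x [n _]|x]; rewrite /F /= !in_itv/=.
    by move=> /andP[nx ->]; rewrite (lt_le_trans _ nx)// invr_gt0 ltr0n.
  move=> /andP[x0 x1]; have [n nx] := ltr_add_invr x0.
  by exists n => //=; rewrite in_itv/= x1 andbT ltW// -[ltLHS]add0r.
have hF : (\int[mu]_(x in F n) (tpow m x)%:E @[n --> \oo] -->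
    \int[mu]_(x in \bigcup_n F n) (tpow m x)%:E)%E.
  apply: ge0_nondecreasing_set_cvg_integral => //.
  - move=> i j ij; rewrite subsetEset; apply: subset_itvr.
    by rewrite bnd_simp lef_pV2 ?posrE ?ltr0n// ler_nat.
  - by move=> i; exact: measurable_itv.
  - by move=> i; apply: measurable_funTS; apply/measurable_EFinP; exact: measurable_tpow.
  - by move=> i x _; rewrite lee_fin tpow_ge0.
rewrite -FE -(cvg_lim _ hF)//; apply: (@le_lt_trans _ _ (m^-1)%:E); last exact: ltry.
apply: lime_le; first by apply/cvg_ex; eexists; exact: hF.
(* [F 0] degenerates to the point 1, where the fundamental theorem has no interval to act on; hence
   [n.+2] from here on. *)
apply: nearW => -[|n].
  rewrite (_ : F 0 = [set 1]) ?integral_set1 ?lee_fin ?invr_ge0 ?ltW//.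
  by rewrite /F invr1 set_itv1.
have n0 : (0 : R) < n.+2%:R^-1 by rewrite invr_gt0 ltr0n.
have n1 : (n.+2%:R^-1 : R) < 1 by rewrite invf_lt1 ?ltr0n// ltr1n.
have dp x : 0 < x -> derivable (fun x : R => x `^ m) x 1.
  by move=> x0; apply: derivable_powR; rewrite in_itv/= x0.
have cp p x : 0 < x -> {for x, continuous (fun x : R => x `^ p)}.
  move=> x0; apply: differentiable_continuous; apply/derivable1_diffP.
  by apply: derivable_powR; rewrite in_itv/= x0.
rewrite (_ : integral _ _ _ =
    \int[mu]_(x in `[(n.+2%:R^-1)%R, 1%R]) (x `^ (m - 1))%:E)%E; last first.
  apply: eq_integral => x; rewrite inE /F/= in_itv/= => /andP[h _].
  by rewrite /tpow (lt_le_trans n0 h).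
rewrite (@continuous_FTC2 _ _ (fun x => m^-1 * x `^ m))//.
- rewrite powR1 mulr1 -EFinB lee_fin gerBl mulr_ge0 ?powR_ge0// invr_ge0.
  exact: ltW.
- apply: continuous_in_subspaceT => x; rewrite inE/= in_itv/= => /andP[h _].
  by apply: cp; exact: lt_le_trans h.
- split.
  + move=> x; rewrite in_itv/= => /andP[h _]; apply: derivableZ; apply: dp.
    exact: lt_trans h.
  + by apply: cvg_at_right_filter; apply: cvgMr; exact: cp.
  + by apply: cvg_at_left_filter; apply: cvgMr; exact: (cp m 1).
- move=> x; rewrite in_itv/= => /andP[h _].
  rewrite derive1E deriveZ/=; last by apply: dp; exact: lt_trans h.
  rewrite -derive1E powR_derive1 ?in_itv/= ?(lt_trans n0 h)//.
  by rewrite /GRing.scale/= mulrA mulVf ?gt_eqF// mul1r.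
Qed.

Lemma integrable_Gamma m : 0 < m ->
  mu.-integrable setT (fun x => (tpow m x * expR (- x))%:E).
Proof.
move=> m0.
have mf : measurable_fun [set: R] (fun x => (tpow m x * expR (- x))%:E).
  apply/measurable_EFinP; apply: measurable_funM; first exact: measurable_tpow.
  by apply: measurableT_comp => //; exact: measurableT_comp.
(* For m > 1 put k = m - 1: raising x / (2k) <= exp(x / (2k)) to the power k gives x^k <= (2k)^k
   exp(x / 2). *)
have [C C0 hC] : exists2 C, 0 <= C & forall x, 1 <= x -> x `^ (m - 1) <= C * expR (x / 2).
  have [m1|m1] := leP m 1.
    exists 1 => // x x1; rewrite mul1r (@le_trans _ _ 1)//.
      by rewrite -[leRHS](powRr0 x) ler_powR// subr_le0.
    by rewrite -expR0 ler_expR divr_ge0// (le_trans _ x1).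
  set k := m - 1; have k0 : 0 < k by rewrite subr_gt0.
  exists ((2 * k) `^ k); first exact: powR_ge0.
  move=> x x1; have x0 : 0 < x by exact: lt_le_trans x1.
  have kx : 0 <= x / (2 * k) by rewrite divr_ge0// ?mulr_ge0// ltW.
  rewrite -[leLHS](_ : (2 * k) `^ k * (x / (2 * k)) `^ k = _); last first.
    rewrite -powRM// ?mulr_ge0 ?(ltW k0)//; congr (_ `^ _).
    by field; rewrite gt_eqF.
  rewrite ler_wpM2l ?powR_ge0//.
  apply: (@le_trans _ _ (expR (x / (2 * k)) `^ k)).
    apply: ge0_ler_powR; rewrite ?nnegrE ?expR_ge0//; first exact: ltW.
    by apply: le_trans (expR_ge1Dx _); rewrite lerDr.
  rewrite -expRM.
  by rewrite ler_expR le_eqVlt; apply/orP; left; apply/eqP; field; rewrite gt_eqF.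
have I1 : mu.-integrable setT ((fun x => (tpow m x)%:E) \_ `]0, 1]).
  rewrite -integrable_mkcond//; apply/integrableP; split.
    by apply/measurable_EFinP; apply: measurable_funTS; exact: measurable_tpow.
  under eq_integral do rewrite gee0_abs ?lee_fin ?tpow_ge0//.
  exact: integral_tpow_itv01_lty.
(* The density is exp(- x / 2) / 2 for x >= 0, so the factor [2 * C] makes the majorant C exp(- x /
   2); it dominates beyond 1, and [I1] dominates on (0, 1]. *)
have I2 : mu.-integrable setT (fun x => (2 * C)%:E * (exponential_pdf (2^-1 : R) x)%:E)%E.
  by apply: integrableZl => //; apply: integrable_exponential_pdf; rewrite invr_gt0.
have I := integrableD measurableT I1 I2.
apply: (le_integrable _ _ _ I) => //= x _.
have e0 : 0 <= exponential_pdf (2^-1 : R) x.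
  by apply: exponential_pdf_ge0; rewrite invr_ge0.
rewrite ger0_norm ?mulr_ge0 ?tpow_ge0 ?expR_ge0//.
rewrite patchE mem_setE in_itv/=.
case: (leP x 0) => x0; first by rewrite tpow_le0// mul0r abse_ge0.
rewrite /=; case: (leP x 1) => x1.
  rewrite -EFinM -EFinD /= lee_fin.
  apply: le_trans (ler_norm _); rewrite ler_wpDr ?mulr_ge0//.
  by rewrite ler_piMr ?tpow_ge0// -expR0 ler_expR oppr_le0 ltW.
rewrite -[point]/(0%E : \bar R) add0e -EFinM /= lee_fin.
apply: le_trans (ler_norm _).
rewrite exponential_pdfE; last exact: ltW.
rewrite /tpow x0.
apply: (@le_trans _ _ (C * expR (x / 2) * expR (- x))).
  by rewrite ler_wpM2r ?expR_ge0// hC// ltW.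
rewrite -mulrA -expRD.
rewrite (_ : x / 2 - x = - 2^-1 * x); last by field.
by rewrite le_eqVlt; apply/orP; left; apply/eqP; field.
Qed.

Lemma GammaE m : 0 < m ->
  ((Gamma m)%:E = \int[mu]_x (tpow m x * expR (- x))%:E)%E.
Proof.
move=> m0; rewrite /Gamma /Rintegral -integral_tpowE fineK//.
by apply: integrable_fin_num => //; exact: integrable_Gamma.
Qed.

(** On [1, 2] the integrand is at least the positive constant [c]; the absolute value in its
    exponent covers both signs of m - 1. *)
Lemma Gamma_gt0 m : 0 < m -> 0 < Gamma m.
Proof.
move=> m0; rewrite -lte_fin GammaE//.
pose c := 2 `^ (- `|m - 1|) * expR (- 2 : R).
apply: (@lt_le_trans _ _ (\int[mu]_(x in `[1%R, 2%R]) c%:E)%E).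
  rewrite integral_cst//= lebesgue_measure_itv/= lte_fin ltr1n -EFinB -EFinM.
  by rewrite lte_fin !mulr_gt0 ?powR_gt0 ?expR_gt0// subr_gt0 ltr1n.
apply: (@le_trans _ _ (\int[mu]_(x in `[1%R, 2%R]) (tpow m x * expR (- x))%:E)%E).
  have mi := measurable_int _ (integrable_Gamma m0).
  apply: ge0_le_integral => //.
  - by move=> x _; rewrite lee_fin mulr_ge0 ?powR_ge0 ?expR_ge0.
  - exact: measurable_funTS.
  - move=> x; rewrite /= in_itv/= => /andP[x1 x2]; rewrite lee_fin.
    have x0 : 0 < x by exact: lt_le_trans x1.
    rewrite /tpow x0; apply: ler_pM; rewrite ?powR_ge0 ?expR_ge0//; last first.
      by rewrite ler_expR lerN2.
    apply: (@le_trans _ _ (x `^ (- `|m - 1|))).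
      by rewrite !powRN lef_pV2 ?posrE ?powR_gt0// ge0_ler_powR// nnegrE ltW.
    by rewrite ler_powR// lerNl -normrN ler_norm.
apply: ge0_subset_integral => //; first exact: measurable_int _ (integrable_Gamma m0).
by move=> x _; rewrite lee_fin mulr_ge0 ?tpow_ge0 ?expR_ge0.
Qed.

End truncated_power.

(** * The Beta integral and the normalised kernel *)

Section riemann_liouville_kernel.
Context {R : realType}.
Implicit Types m n x y t r : R.
Local Notation mu := (@lebesgue_measure R).

(** Homogeneity: the substitution x -> u x contributes u from the measure and u^(m - 1) u^(n - 1)
    from the two powers. *)
Lemma integral_conv_tpow_scale m n u : 0 < m -> 0 < n ->
  (\int[mu]_x (tpow m (u - x) * tpow n x)%:E =
   (tpow (m + n) u)%:E * \int[mu]_x (tpow m (1 - x) * tpow n x)%:E)%E.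
Proof.
move=> m0 n0.
have mf v : measurable_fun [set: R] (fun x => (tpow m (v - x) * tpow n x)%:E).
  apply/measurable_EFinP; apply: measurable_funM; last exact: measurable_tpow.
  by apply: measurableT_comp; [exact: measurable_tpow|exact: measurable_funB].
have [u0|u0] := leP u 0.
  rewrite (tpow_le0 _ u0) mul0e integral0_eq// => x _.
  have [x0|x0] := leP x 0; first by rewrite (tpow_le0 _ x0) mulr0.
  by rewrite (@tpow_le0 _ m) ?mul0r//; lra.
have f0 x : (0 <= (tpow m (u - x) * tpow n x)%:E)%E.
  by rewrite lee_fin mulr_ge0 ?tpow_ge0.
rewrite [LHS](ge0_integral_affine 0 u0 (mf u) f0).
under eq_integral => x _.
  rewrite add0r (_ : u - u * x = u * (1 - x)); last by ring.
  rewrite !tpowM// mulrACA EFinM; over.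
rewrite ge0_integralZl_EFin ?mulr_ge0 ?powR_ge0//; first last.
- exact: mf.
- by move=> x _; rewrite lee_fin mulr_ge0 ?tpow_ge0.
rewrite muleA -EFinM; congr (_%:E * _)%E.
rewrite /tpow u0 -powRD; last by rewrite (gt_eqF u0) implybT.
have -> : m + n - 1 = 1 + (m - 1 + (n - 1)) by ring.
by rewrite [RHS]powRD ?(gt_eqF u0) ?implybT// powRr1// ltW.
Qed.

(** Euler's Beta identity. Write Gamma n Gamma m as a double integral, shift y to u = x + y, and
    exchange the order by Tonelli: the inner integral in x is homogeneous in u, leaving [B] times
    Gamma (m + n). *)
Lemma integral_conv_tpow m n t r : 0 < m -> 0 < n ->
  (\int[mu]_s (tpow m (t - s) * tpow n (s - r))%:E =
   (Gamma m * Gamma n / Gamma (m + n) * tpow (m + n) (t - r))%:E)%E.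
Proof.
move=> m0 n0; have mn0 : 0 < m + n by exact: addr_gt0.
set B := (\int[mu]_x (tpow m (1 - x) * tpow n x)%:E)%E.
have mfl v : measurable_fun [set: R] (fun x => tpow m (v - x)).
  by apply: measurableT_comp; [exact: measurable_tpow|exact: measurable_funB].
have mfr v : measurable_fun [set: R] (fun x => tpow n (x - v)).
  by apply: measurableT_comp; [exact: measurable_tpow|exact: measurable_funB].
have mG p : measurable_fun [set: R] (fun x => tpow p x * expR (- x)).
  apply: measurable_funM; first exact: measurable_tpow.
  by apply: measurableT_comp => //; exact: measurableT_comp.
have BE u : (\int[mu]_x (tpow m (u - x) * tpow n x)%:E = (tpow (m + n) u)%:E * B)%E.
  exact: integral_conv_tpow_scale.
rewrite (@ge0_integral_affine _ 1 r)//; first last.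
- by move=> x; rewrite lee_fin mulr_ge0 ?tpow_ge0.
- by apply/measurable_EFinP; exact: measurable_funM.
under eq_integral => x _.
  rewrite mul1r (_ : t - (r + x) = t - r - x); last by ring.
  rewrite (_ : r + x - r = x); last by ring.
  over.
rewrite mul1e BE.
suff -> : B = (Gamma m * Gamma n / Gamma (m + n))%:E by rewrite -EFinM mulrC.
suff GB : ((Gamma n)%:E * (Gamma m)%:E = (Gamma (m + n))%:E * B)%E.
  have G0 := Gamma_gt0 mn0.
  (* Finiteness of [B] is itself read off [GB]: an infinite [B] would make the right side infinite,
     while the left side is a real number. *)
  have Bfin : B \is a fin_num.
    rewrite ge0_fin_numE; last first.
      by apply: integral_ge0 => x _; rewrite lee_fin mulr_ge0 ?tpow_ge0.
    rewrite ltey; apply/eqP => By; move: GB.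
    by rewrite By gt0_muley ?lte_fin// -EFinM.
  move: GB; rewrite -(fineK Bfin) -!EFinM => -[GB]; congr EFin.
  by rewrite (mulrC (Gamma m)) GB mulrC mulKf// gt_eqF.
(* [h] is the integrand of [Gamma n * Gamma m] in the coordinates [(x, x + y)]. *)
pose h (p : R * R) := (tpow n p.1 * tpow m (p.2 - p.1) * expR (- p.2))%:E.
have mh : measurable_fun setT h.
  apply/measurable_EFinP; apply: measurable_funM.
    apply: measurable_funM.
      by apply: measurableT_comp; [exact: measurable_tpow|exact: measurable_fst].
    apply: measurableT_comp; first exact: measurable_tpow.
    by apply: measurable_funB; [exact: measurable_snd|exact: measurable_fst].
  apply: measurableT_comp => //; apply: measurableT_comp => //.
have h0 p : (0 <= h p)%E by rewrite lee_fin !mulr_ge0 ?tpow_ge0 ?expR_ge0.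
transitivity (\int[mu]_x \int[mu]_u h (x, u))%E.
  rewrite GammaE// -ge0_integralZr//; first last.
  - by rewrite lee_fin ltW// Gamma_gt0.
  - by move=> x _; rewrite lee_fin mulr_ge0 ?tpow_ge0 ?expR_ge0.
  - by apply/measurable_EFinP; exact: mG.
  apply: eq_integral => x _.
  rewrite GammaE// -ge0_integralZl//; first last.
  - by rewrite lee_fin mulr_ge0 ?tpow_ge0 ?expR_ge0.
  - by move=> y _; rewrite lee_fin mulr_ge0 ?tpow_ge0 ?expR_ge0.
  - by apply/measurable_EFinP; exact: mG.
  rewrite [RHS](@ge0_integral_affine _ 1 x)//; last first.
    exact: (measurableT_comp mh (measurable_pair1 x)).
  rewrite mul1e; apply: eq_integral => u _.
  rewrite mul1r /h /= -EFinM; congr EFin.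
  rewrite mulrACA -expRD (_ : x + u - x = u); last by ring.
  by congr (_ * expR _); ring.
rewrite fubini_tonelli//.
transitivity (\int[mu]_u (B * (tpow (m + n) u * expR (- u))%:E))%E.
  apply: eq_integral => u _.
  transitivity ((\int[mu]_x (tpow m (u - x) * tpow n x)%:E) * (expR (- u))%:E)%E; last first.
    by rewrite (BE u) EFinM muleA (muleC B).
  have mk : measurable_fun [set: R] (fun x => (tpow m (u - x) * tpow n x)%:E).
    apply/measurable_EFinP; apply: measurable_funM; first exact: mfl.
    exact: measurable_tpow.
  have k0 x : [set: R] x -> (0 <= (tpow m (u - x) * tpow n x)%:E)%E.
    by rewrite lee_fin mulr_ge0 ?tpow_ge0.
  have e0 : (0 <= (expR (- u))%:E)%E by rewrite lee_fin expR_ge0.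
  rewrite -(ge0_integralZr mu measurableT mk k0 e0).
  by apply: eq_integral => x _; rewrite /h/= -EFinM (mulrC (tpow n x)).
rewrite ge0_integralZl//; first last.
- by apply: integral_ge0 => x _; rewrite lee_fin mulr_ge0 ?tpow_ge0.
- by move=> x _; rewrite lee_fin mulr_ge0 ?tpow_ge0 ?expR_ge0.
- by apply/measurable_EFinP; exact: mG.
by rewrite -GammaE// muleC.
Qed.

(** The Riemann-Liouville kernel. Dividing by Gamma makes orders add under convolution with no Beta
    factor left over. *)
Definition rlk m x : R := tpow m x / Gamma m.

Lemma rlk_ge0 m x : 0 < m -> 0 <= rlk m x.
Proof. by move=> m0; rewrite divr_ge0 ?tpow_ge0// ltW ?Gamma_gt0. Qed.

Lemma rlk_gt0 m x : 0 < m -> 0 < x -> 0 < rlk m x.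
Proof. by move=> m0 x0; rewrite divr_gt0 ?tpow_gt0 ?Gamma_gt0. Qed.

Lemma rlk_le0 m x : x <= 0 -> rlk m x = 0.
Proof. by move=> x0; rewrite /rlk tpow_le0// mul0r. Qed.

Lemma rlkE m x : 0 < x -> rlk m x = x `^ (m - 1) / Gamma m.
Proof. by move=> x0; rewrite /rlk /tpow x0. Qed.

Lemma measurable_rlk m : measurable_fun [set: R] (rlk m).
Proof. by apply: measurable_funM; [exact: measurable_tpow|]. Qed.

Lemma rlkM m x y : 0 < x -> rlk m (x * y) = x `^ (m - 1) * rlk m y.
Proof. by move=> x0; rewrite /rlk tpowM// mulrA. Qed.

Lemma integral_conv_rlk m n t r : 0 < m -> 0 < n ->
  (\int[mu]_s (rlk m (t - s) * rlk n (s - r))%:E = (rlk (m + n) (t - r))%:E)%E.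
Proof.
move=> m0 n0.
have G0 (p : R) : 0 < p -> Gamma p != 0 by move=> p0; rewrite gt_eqF// Gamma_gt0.
under eq_integral => s _ do rewrite /rlk mulrACA -invfM mulrC EFinM.
rewrite ge0_integralZl_EFin//; first last.
- by rewrite invr_ge0 mulr_ge0// ltW// Gamma_gt0.
- apply/measurable_EFinP; apply: measurable_funM;
    (apply: measurableT_comp; [exact: measurable_tpow|exact: measurable_funB]).
- by move=> s _; rewrite lee_fin mulr_ge0 ?tpow_ge0.
rewrite integral_conv_tpow// -EFinM; congr EFin; rewrite /rlk.
have aux (x y z : R) : x != 0 -> x^-1 * (x / y * z) = z / y.
  by move=> x0; rewrite -(mulrA x) mulKf// mulrC.
exact: (aux _ _ _ (mulf_neq0 (G0 _ m0) (G0 _ n0))).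
Qed.

End riemann_liouville_kernel.

(** * Convolution of the kernel with weighted functions *)

Section weighted_convolution.
Context {R : realType}.
Implicit Types m n g x y t r : R.
Local Notation mu := (@lebesgue_measure R).

Definition rlconv m (phi : R -> R) t : R :=
  \int[mu]_s (rlk m (t - s) * phi s).

Definition rlk_weight (a g : R) (G : R -> R) (s : R) : R := rlk g (s - a) * G s.

Lemma rlk_weight_le a g G s : s <= a -> rlk_weight a g G s = 0.
Proof. by move=> sa; rewrite /rlk_weight rlk_le0 ?mul0r// subr_le0. Qed.

Lemma rlk2_ge0 m n x y : 0 < m -> 0 < n -> 0 <= rlk m x * rlk n y.
Proof. by move=> m0 n0; rewrite mulr_ge0 ?rlk_ge0. Qed.

Lemma measurable_rlk_subl m v : measurable_fun [set: R] (fun x => rlk m (v - x)).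
Proof.
by apply: measurableT_comp; [exact: measurable_rlk|exact: measurable_funB].
Qed.

Lemma measurable_rlk_subr m v : measurable_fun [set: R] (fun x => rlk m (x - v)).
Proof.
by apply: measurableT_comp; [exact: measurable_rlk|exact: measurable_funB].
Qed.

Lemma integrable_rlk2 m n t a : 0 < m -> 0 < n ->
  mu.-integrable setT (fun s => (rlk m (t - s) * rlk n (s - a))%:E).
Proof.
move=> m0 n0; apply/integrableP; split.
  apply/measurable_EFinP; apply: measurable_funM.
    exact: measurable_rlk_subl.
  exact: measurable_rlk_subr.
rewrite (_ : integral _ _ _ = (rlk (m + n) (t - a))%:E) ?ltry//.
rewrite -integral_conv_rlk//; apply: eq_integral => s _.
by rewrite gee0_abs// lee_fin rlk2_ge0.
Qed.

Section fixed_weight.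
Variables (a g : R) (G : R -> R) (M : R).
Hypotheses (g0 : 0 < g) (mG : measurable_fun [set: R] G)
  (GM : forall x, `|G x| <= M).

Lemma measurable_rlk_weight : measurable_fun [set: R] (rlk_weight a g G).
Proof. by apply: measurable_funM => //; exact: measurable_rlk_subr. Qed.

Lemma integrable_rlk_rlk_weight m t : 0 < m ->
  mu.-integrable setT (fun s => (rlk m (t - s) * rlk_weight a g G s)%:E).
Proof.
move=> m0.
have I := integrableZl measurableT M (@integrable_rlk2 m g t a m0 g0).
apply: le_integrable I => //.
  apply/measurable_EFinP; apply: measurable_funM.
    exact: measurable_rlk_subl.
  exact: measurable_rlk_weight.
have aux (p q v : R) : `|v| <= M -> `|p * (q * v)| <= `|M * (p * q)|.
  move=> vM; rewrite mulrA normrM (mulrC _ `|v|) (normrM M).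
  by apply: ler_wpM2r => //; exact: le_trans vM (ler_norm M).
by move=> s _; rewrite lee_fin; exact: (aux _ _ _ (GM s)).
Qed.

(** Comparison with a constant factor, for which the convolution is exact. A bound on [G] over (a,
    t) suffices, as one of the two kernels vanishes elsewhere. *)
Lemma rlconv_bound m t K : 0 < m -> (forall s, a < s < t -> `|G s| <= K) ->
  `|rlconv m (rlk_weight a g G) t| <= K * rlk (m + g) (t - a).
Proof.
move=> m0 GK.
have I := integrable_rlk_rlk_weight t m0.
have I2 := integrable_rlk2 t a m0 g0.
apply: (le_trans (le_normr_Rintegral measurableT I)).
rewrite -[rlk (m + g) (t - a)]/(fine (EFin _)) -integral_conv_rlk//.
rewrite -/(Rintegral _ _ _) -RintegralZl//.
apply: le_Rintegral => //.
- have := integrable_norm I; apply: eq_integrable => //.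
- exact: (integrableZl measurableT K I2).
move=> s _ /=; rewrite /rlk_weight.
have [sa|sa] := leP s a.
  by rewrite !(@rlk_le0 _ _ (s - a)) ?subr_le0// !(mul0r,mulr0) normr0.
have [st|st] := leP t s.
  by rewrite !(@rlk_le0 _ _ (t - s)) ?subr_le0// !(mul0r,mulr0) normr0.
rewrite mulrA normrM mulrC [X in _ * X]ger0_norm ?rlk2_ge0//.
by rewrite ler_wpM2r ?rlk2_ge0// GK// sa.
Qed.

End fixed_weight.

(* The substitution s = a + (t - a) x fixes the domain, so that continuity in t
   of the integral becomes dominated convergence. *)
Lemma rlconv_scale (a g : R) (G : R -> R) (M : R) m t : 0 < g ->
  measurable_fun [set: R] G -> (forall x, `|G x| <= M) -> 0 < m -> a < t ->
  rlconv m (rlk_weight a g G) t = (t - a) `^ (m + g - 1) *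
    rlconv m (rlk_weight 0 g (fun x => G (a + (t - a) * x))) 1.
Proof.
move=> g0 mG GM m0 ta; have k0 : 0 < t - a by rewrite subr_gt0.
have mf : measurable_fun [set: R] (fun s => rlk m (t - s) * rlk_weight a g G s).
  apply: measurable_funM; first exact: measurable_rlk_subl.
  exact: (measurable_rlk_weight a g mG).
rewrite [LHS](Rintegral_affine a k0 mf) {mf}.
have mG' : measurable_fun [set: R] (fun x => G (a + (t - a) * x)).
  apply: measurableT_comp => //; apply: measurable_funD => //.
have I := integrable_rlk_rlk_weight 0 g0 mG' (fun x => GM _) 1 m0.
pose J := \int[mu]_s (rlk m (1 - s) * rlk_weight 0 g (fun x => G (a + (t - a) * x)) s).
transitivity ((t - a) * (((t - a) `^ (m - 1) * (t - a) `^ (g - 1)) * J)).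
  congr (_ * _); rewrite /rlconv -RintegralZl//; apply: eq_Rintegral => x _.
  have -> : t - (a + (t - a) * x) = (t - a) * (1 - x) by ring.
  have xE : a + (t - a) * x - a = (t - a) * x by ring.
  have aux (p q u v w : R) : p * u * (q * v * w) = p * q * (u * (v * w)) by ring.
  by rewrite /rlk_weight subr0 xE (rlkM _ (1 - x) k0) (rlkM _ x k0) aux.
rewrite mulrA; congr (_ * _).
have k0' : t - a != 0 by rewrite gt_eqF.
have -> : m + g - 1 = 1 + (m - 1 + (g - 1)) by ring.
have tD u v : (t - a) `^ (u + v) = (t - a) `^ u * (t - a) `^ v.
  by apply: powRD; rewrite k0' implybT.
by rewrite (tD 1) (tD (m - 1) (g - 1)) powRr1// ltW.
Qed.

Lemma continuous_rlconv_scaled (a g : R) (G : R -> R) (M : R) m : 0 < g -> 0 < m ->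
  continuous G -> (forall x, `|G x| <= M) ->
  continuous (fun t => rlconv m (rlk_weight 0 g (fun x => G (a + (t - a) * x))) 1).
Proof.
move=> g0 m0 cG GM t.
have mG' y : measurable_fun [set: R] (fun x => G (a + (y - a) * x)).
  apply: measurableT_comp; first exact: continuous_measurable_fun.
  by apply: measurable_funD => //.
have I2 := integrableZl measurableT M (@integrable_rlk2 m g 1 0 m0 g0).
apply: (@continuity_under_integral _ _ _ mu _ setT measurableT (t - 1) (t + 1) _ _
    (fun x => M * (rlk m (1 - x) * rlk g (x - 0)))) => //.
- move=> y _; exact: (integrable_rlk_rlk_weight 0 g0 (mG' y) (fun x => GM _) 1 m0).
- apply: aeW => x _ y _; apply: cvgMr; apply: cvgMr.
  apply: (@continuous_comp _ _ _ (fun y => a + (y - a) * x) G); last exact: cG.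
  by apply: cvgD; [exact: cvg_cst|apply: cvgMl; apply: cvgB; [exact: cvg_id|exact: cvg_cst]].
- move=> y _; apply: aeW => x _; rewrite /rlk_weight mulrA normrM mulrC.
  rewrite [X in _ * X]ger0_norm ?rlk2_ge0//.
  by rewrite ler_wpM2r ?rlk2_ge0.
- by rewrite inE/= in_itv/= ltrBlDr ltrDl ltr01.
Qed.

Lemma rlconv_semigroup (a g : R) (G : R -> R) (M : R) m n t : 0 < g ->
  measurable_fun [set: R] G -> (forall x, `|G x| <= M) -> 0 < m -> 0 < n ->
  rlconv m (rlconv n (rlk_weight a g G)) t = rlconv (m + n) (rlk_weight a g G) t.
Proof.
move=> g0 mG GM m0 n0.
have M0 : 0 <= M by exact: le_trans (GM 0).
have mw := @measurable_rlk_weight a g G mG.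
pose h (p : R * R) := (rlk m (t - p.1) * (rlk n (p.1 - p.2) * rlk_weight a g G p.2))%:E.
have mh : measurable_fun setT h.
  apply/measurable_EFinP; apply: measurable_funM.
    apply: measurableT_comp; first exact: measurable_rlk.
    by apply: measurable_funB => //; exact: measurable_fst.
  apply: measurable_funM.
    apply: measurableT_comp; first exact: measurable_rlk.
    by apply: measurable_funB; [exact: measurable_fst|exact: measurable_snd].
  by apply: measurableT_comp => //; exact: measurable_snd.
have Ih : (mu \x mu)%E.-integrable setT h.
  apply/integrable12ltyP => //.
  (* This bound is the iterated integral of the same kernels with the constant [M] in place of [G],
     evaluated by applying [integral_conv_rlk] twice. *)
  apply: (@le_lt_trans _ _ (M * rlk (m + (n + g)) (t - a))%:E); last exact: ltry.
  rewrite EFinM -integral_conv_rlk ?addr_gt0//.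
  rewrite -ge0_integralZl_EFin//; first last.
  - apply/measurable_EFinP; apply: measurable_funM.
      exact: measurable_rlk_subl.
    exact: measurable_rlk_subr.
  - by move=> s _; rewrite lee_fin rlk2_ge0 ?addr_gt0.
  apply: ge0_le_integral => //.
  - by move=> s _; apply: integral_ge0 => r _; exact: abse_ge0.
  - apply: (@measurable_fun_fubini_tonelli_F _ _ _ _ _ mu (fun p => `|h p|)%E) => //.
    exact: measurableT_comp.
  - apply/measurable_EFinP; apply: measurable_funM => //; apply: measurable_funM.
      exact: measurable_rlk_subl.
    exact: measurable_rlk_subr.
  move=> s _.
  have c0 : 0 <= M * rlk m (t - s) by rewrite mulr_ge0 ?rlk_ge0.
  have mk : measurable_fun [set: R] (fun r => (rlk n (s - r) * rlk g (r - a))%:E).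
    apply/measurable_EFinP; apply: measurable_funM.
      exact: measurable_rlk_subl.
    exact: measurable_rlk_subr.
  have k0 r : (0 <= (rlk n (s - r) * rlk g (r - a))%:E)%E by rewrite lee_fin rlk2_ge0.
  rewrite -EFinM mulrA EFinM -integral_conv_rlk//.
  rewrite -ge0_integralZl_EFin//.
  apply: ge0_le_integral => //.
  - apply: measurableT_comp => //.
    exact: (measurableT_comp mh (measurable_pair1 s)).
  - exact: measurable_funeM.
  have aux (p q u v : R) : 0 <= p -> 0 <= q -> 0 <= u -> `|v| <= M ->
      `|p * (q * (u * v))| <= M * p * (q * u).
    move=> p0 q0 u0 vM; rewrite !normrM (ger0_norm p0) (ger0_norm q0) (ger0_norm u0).
    rewrite [leLHS](_ : _ = `|v| * (p * (q * u))); last by ring.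
    by rewrite -mulrA ler_wpM2r ?mulr_ge0.
  move=> r _; rewrite -EFinM lee_fin.
  exact: (aux _ _ _ _ (rlk_ge0 _ m0) (rlk_ge0 _ n0) (rlk_ge0 _ g0) (GM r)).
rewrite /rlconv /Rintegral.
transitivity (fine (\int[mu]_s \int[mu]_r h (s, r))%E).
  congr fine; apply: eq_integral => s _.
  have I := integrable_rlk_rlk_weight a g0 mG GM s n0.
  rewrite EFinM fineK; last exact: integrable_fin_num.
  by rewrite -integralZl.
rewrite Fubini//; congr fine; apply: eq_integral => r _; rewrite /h/=.
under eq_integral => s _ do rewrite mulrA mulrC EFinM.
rewrite integralZl//.
  by rewrite integral_conv_rlk// -EFinM mulrC.
exact: integrable_rlk2.
Qed.

(** The bridge from the definition to convolution on the line: [phi] vanishes up to a and the kernel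
    vanishes from t on, so only values on (a, t) count. Integrability allows Gamma to be taken out
    of the integral. *)
Lemma RL_integral_rlconv (a m t : R) (phi h : R -> R) : 0 < m ->
  (forall s, s <= a -> phi s = 0) -> (forall s, a < s < t -> h s = phi s) ->
  mu.-integrable setT (fun s => (rlk m (t - s) * phi s)%:E) ->
  RL_integral a m h t = rlconv m phi t.
Proof.
move=> m0 phi0 hphi I; rewrite /RL_integral (gt_eqF m0) /rlconv.
have E : (fun s => Gamma m * (rlk m (t - s) * phi s)) =
   (fun s => (t - s) `^ (m - 1) * h s) \_ `]a, t[.
  apply/funext => s; rewrite patchE mem_setE in_itv/=.
  have [sa|sa] := leP s a; first by rewrite phi0// !mulr0.
  have [st|st] := leP t s; first by rewrite rlk_le0 ?subr_le0// mul0r mulr0.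
  rewrite /= hphi ?sa// rlkE ?subr_gt0// mulrA; congr (_ * _).
  by rewrite mulrC divfK// gt_eqF// Gamma_gt0.
rewrite Rintegral_mkcond -E RintegralZl// mulKf// gt_eqF// Gamma_gt0//.
Qed.

End weighted_convolution.

(** * Functions with a kernel weight and a continuous factor *)

Section weighted_class.
Context {R : realType}.
Implicit Types (a b g m n w t : R) (h G : R -> R).
Local Notation mu := (@lebesgue_measure R).

Lemma continuous_powR p t : 0 < t -> {for t, continuous (fun x : R => x `^ p)}.
Proof.
move=> t0; apply: differentiable_continuous; apply/derivable1_diffP.
by apply: derivable_powR; rewrite in_itv/= t0.
Qed.

Lemma near_eq_continuous (f h : R -> R) t :
  (\forall x \near t, f x = h x) -> {for t, continuous f} -> {for t, continuous h}.
Proof.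
move=> fh cf; rewrite /prop_for /continuous_at -(nbhs_singleton fh).
by apply: cvg_trans cf; exact: near_eq_cvg.
Qed.

Lemma continuous_rlk g t : 0 < t -> {for t, continuous (rlk g)}.
Proof.
move=> t0; apply: (@near_eq_continuous (fun x => x `^ (g - 1) * (Gamma g)^-1)).
  near=> x; rewrite rlkE//; near: x; exact: lt_nbhsr.
by apply: cvgMl; exact: continuous_powR.
Unshelve. all: by end_near. Qed.

Lemma continuous_rlk_weight a g G t : a < t -> {for t, continuous G} ->
  {for t, continuous (rlk_weight a g G)}.
Proof.
move=> ta cG; apply: cvgM => //.
apply: (@continuous_comp _ _ _ (fun x => x - a) (rlk g)); last first.
  by apply: continuous_rlk; rewrite subr_gt0.
by apply: cvgB; [exact: cvg_id|exact: cvg_cst].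
Qed.

(* For [0 < g <= 1] this is [C_(1 - g)[a, b]]; unlike the weighted spaces, the
   classes compose under fractional integration: [I^m] maps [g] to [m + g]. *)
Definition rlk_class a b g h := exists (G : R -> R) (M : R), [/\ continuous G,
  forall x, `|G x| <= M & forall t, a < t <= b -> h t = rlk_weight a g G t].

Lemma subr_cvg_right a : (fun x => x - a) x @[x --> a^'+] --> (0:R)^'+.
Proof.
move=> A [e /= e0 eA]; exists e => //= x /= xe ax; apply: eA => //=; last first.
  by rewrite subr_gt0.
by rewrite sub0r normrN; move: xe; rewrite distrC.
Qed.

Lemma powR_subr_cvg0 a p : 0 < p -> (t - a) `^ p @[t --> a^'+] --> 0.
Proof.
by move=> p0 A /(powR_cvg0 p0) /(@subr_cvg_right a).
Qed.

Lemma near_right_oc a b : a < b -> \forall x \near a^'+, a < x <= b.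
Proof.
move=> ab; near=> x; apply/andP; split; near: x; first exact: nbhs_right_gt.
exact: nbhs_right_le.
Unshelve. all: by end_near. Qed.

Lemma wC_of_continuous a b w h H : a < b ->
  (forall t, a < t -> {for t, continuous H}) -> cvg (H t @[t --> a^'+]) ->
  (forall t, a < t <= b -> (t - a) `^ w * h t = H t) -> wC a b w h.
Proof.
move=> ab cH lH hH; split.
  apply: (@subspace_eq_continuous _ _ _ H).
    by move=> x; rewrite inE/= in_itv/= => xab; exact/esym/hH.
  apply: continuous_in_subspaceT => x; rewrite inE/= in_itv/= => /andP[ax _].
  exact: cH.
move/cvg_ex : lH => [l lH]; apply/cvg_ex; exists l; apply: cvg_trans lH.
apply: near_eq_cvg; near=> x; rewrite hH//; near: x; exact: near_right_oc.
Unshelve. all: by end_near. Qed.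

(** The weighted function, completed by its limit at a, is continuous on the compact [a, b];
    Tietze's theorem extends it to a bounded continuous function on the line. The factor Gamma (1 -
    w) undoes the normalisation of [rlk]. *)
Lemma wC_rlk_class a b w h : a < b -> w < 1 -> wC a b w h -> rlk_class a b (1 - w) h.
Proof.
move=> ab w1 [cf /cvg_ex[l fl]]; set f := fun t => (t - a) `^ w * h t in cf fl.
pose H t := if t <= a then l else f t.
have cf1 t : a < t < b -> {for t, continuous f}.
  move=> tab; have : {in `]a, b[, continuous f}.
    apply/in_continuous_mksetP; rewrite -continuous_open_subspace; last exact: interval_open.
    by apply: continuous_subspaceW cf; apply: subset_itvl; rewrite bnd_simp.
  by apply; rewrite in_itv.
have cH : {within `[a, b], continuous H}.
  apply/continuous_within_itvP => //; split.
  - move=> x; rewrite in_itv/= => /andP[ax xb].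
    apply: (@near_eq_continuous f); last by apply: cf1; rewrite ax.
    near=> y; rewrite /H ifF//; apply/negbTE; rewrite -ltNge; near: y.
    exact: lt_nbhsr.
  - rewrite {2}/H lexx; apply: cvg_trans fl; apply: near_eq_cvg; near=> y.
    rewrite /H ifF//; apply/negbTE; rewrite -ltNge; near: y; exact: nbhs_right_gt.
  - rewrite {2}/H leNgt ab /=.
    pose c := (a + b) / 2; have [ac cb] : a < c /\ c < b by rewrite midf_lt ?midf_lt.
    have : {within `[c, b], continuous f}.
      apply: continuous_subspaceW cf => x /=; rewrite !in_itv/= => /andP[cx ->].
      by rewrite (lt_le_trans ac).
    move=> /(continuous_within_itvP _ cb)[_ _]; apply: cvg_trans.
    apply: near_eq_cvg; near=> y; rewrite /H ifF//; apply/negbTE; rewrite -ltNge.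
    near: y; exact: nbhs_left_gt.
have /compact_bounded[M [_ HM]] : compact (H @` `[a, b]).
  by apply: continuous_compact => //; exact: segment_compact.
(* [compact_bounded] gives a bound for each constant strictly above [M], and the extension needs a
   positive one; [|M| + 1] is both. *)
have M1 : 0 < `|M| + 1 by rewrite ltr_wpDl.
have [G [GH cG GM]] := @continuous_bounded_extension R R pseudometric_normal _
   (@itv_closed _ R a b) H _ M1 cH
   (fun x Ax => HM _ (ltr_pwDr ltr01 (ler_norm _)) _ (ex_intro2 _ _ x Ax erefl)).
have g0 : 0 < Gamma (1 - w) by apply: Gamma_gt0; rewrite subr_gt0.
exists (fun t => Gamma (1 - w) * G t), (Gamma (1 - w) * (`|M| + 1)); split.
- by move=> t; apply: cvgMr; exact: cG.
- by move=> t; rewrite normrM (gtr0_norm g0) ler_wpM2l// ltW.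
move=> t /andP[ta tb]; rewrite /rlk_weight -GH; last by rewrite inE/= in_itv/= tb ltW.
rewrite rlkE ?subr_gt0// /H leNgt ta /= /f.
have -> : 1 - w - 1 = - w by ring.
rewrite powRN; have P : (t - a) `^ w != 0 by rewrite gt_eqF// powR_gt0// subr_gt0.
by field; rewrite P gt_eqF.
Unshelve. all: by end_near. Qed.

(** The weight leaves the power w + g - 1 >= 0 in front of the factor: it is constant or tends to 0
    at a, so the limit at a exists. This brings the higher orders produced by fractional integration
    back into the weighted space. *)
Lemma rlk_class_wC a b w g h : a < b -> 1 - w <= g -> rlk_class a b g h -> wC a b w h.
Proof.
move=> ab wg [G [M [cG GM hG]]].
pose H t := (t - a) `^ (w + (g - 1)) * ((Gamma g)^-1 * G t).
apply: (@wC_of_continuous _ _ _ _ H) => //.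
- move=> t ta; apply: cvgM; last by apply: cvgMr; exact: cG.
  apply: (@continuous_comp _ _ _ (fun x => x - a) (fun x => x `^ _)); last first.
    by apply: continuous_powR; rewrite subr_gt0.
  by apply: cvgB; [exact: cvg_id|exact: cvg_cst].
- apply: is_cvgM; last first.
    by apply/cvg_ex; eexists; apply: cvg_at_right_filter; apply: cvgMr; exact: cG.
  have [p0|p0] := eqVneq (w + (g - 1)) 0.
    rewrite p0; apply/cvg_ex; exists 1; under eq_fun do rewrite powRr0; exact: cvg_cst.
  apply/cvg_ex; exists 0.
  apply: powR_subr_cvg0; rewrite lt_neqAle eq_sym p0; lra.
move=> t /andP[ta tb]; rewrite hG ?ta// /rlk_weight rlkE ?subr_gt0// /H.
rewrite [in RHS]powRD; last by rewrite (gt_eqF (_ : 0 < t - a)) ?implybT// subr_gt0.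
by rewrite !mulrA.
Qed.

Lemma rlk_class_cvg0 a b g h : a < b -> 1 < g -> rlk_class a b g h -> h t @[t --> a^'+] --> 0.
Proof.
move=> ab g1 [G [M [cG GM hG]]].
have : (t - a) `^ (g - 1) * ((Gamma g)^-1 * G t) @[t --> a^'+] --> 0 * ((Gamma g)^-1 * G a).
  apply: cvgM; last by apply: cvg_at_right_filter; apply: cvgMr; exact: cG.
  by apply: powR_subr_cvg0; rewrite subr_gt0.
rewrite mul0r; apply: cvg_trans; apply: near_eq_cvg; near=> t.
have /andP[ta tb] : a < t <= b by near: t; exact: near_right_oc.
by rewrite hG ?ta// /rlk_weight rlkE ?subr_gt0// mulrA.
Unshelve. all: by end_near. Qed.

Lemma rlk_class_cvg_left a b g h : a < b -> rlk_class a b g h -> h t @[t --> b^'-] --> h b.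
Proof.
move=> ab [G [M [cG GM hG]]]; rewrite hG ?ab ?lexx//.
have : rlk_weight a g G t @[t --> b^'-] --> rlk_weight a g G b.
  by apply: cvg_at_left_filter; exact: (@continuous_rlk_weight a g G b ab (cG b)).
apply: cvg_trans; apply: near_eq_cvg; near=> t; rewrite hG//.
apply/andP; split; near: t; first exact: nbhs_left_gt.
exact: nbhs_left_le.
Unshelve. all: by end_near. Qed.

Lemma rlk_class_within a b g h : rlk_class a b g h -> {within `]a, b], continuous h}.
Proof.
move=> [G [M [cG GM hG]]]; apply: (@subspace_eq_continuous _ _ _ (rlk_weight a g G)).
  by move=> x; rewrite inE/= in_itv/= => xab; exact/esym/hG.
apply: continuous_in_subspaceT => x; rewrite inE/= in_itv/= => /andP[ax _].
exact: (@continuous_rlk_weight a g G x ax (cG x)).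
Qed.

(** Scaling extracts the power m + g - 1, and the remaining factor [Phi] is an integral over a fixed
    domain, continuous and bounded in t. The identity includes t <= a, where both sides vanish, so
    it can be used by functional extensionality inside a further convolution. *)
Lemma rlconv_rlk_weight a g m G (M : R) : 0 < g -> 0 < m -> continuous G ->
  (forall x, `|G x| <= M) -> exists (G' : R -> R) (M' : R), [/\ continuous G',
  forall x, `|G' x| <= M' & forall t, rlconv m (rlk_weight a g G) t = rlk_weight a (m + g) G' t].
Proof.
move=> g0 m0 cG GM; have mg0 : 0 < m + g by exact: addr_gt0.
have G0 := Gamma_gt0 mg0; have mG := continuous_measurable_fun cG.
pose Phi t := rlconv m (rlk_weight 0 g (fun x => G (a + (t - a) * x))) 1.
have PhiM t : `|Phi t| <= M * rlk (m + g) (1 - 0).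
  apply: (@rlconv_bound _ _ _ _ M) => //.
  by apply: measurableT_comp => //; apply: measurable_funD => //.
exists (fun t => Gamma (m + g) * Phi t), (Gamma (m + g) * (M * rlk (m + g) (1 - 0))); split.
- by move=> t; apply: cvgMr; exact: (@continuous_rlconv_scaled R a g G M m g0 m0 cG GM t).
- by move=> t; rewrite normrM (gtr0_norm G0) ler_wpM2l// ltW.
move=> t; have [ta|ta] := leP t a.
  rewrite rlk_weight_le// /rlconv /Rintegral integral0_eq// => s _.
  have [sa|sa] := leP s a; first by rewrite rlk_weight_le// mulr0.
  by rewrite rlk_le0 ?mul0r// subr_le0 (le_trans ta)// ltW.
rewrite (rlconv_scale g0 mG GM m0 ta) /rlk_weight (rlkE (m + g)) ?subr_gt0//.
by rewrite -/(rlk_weight _ _ _) -/(Phi t) mulrA divfK// gt_eqF.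
Qed.

Section representation.
Variables (a b g : R) (h G : R -> R) (M : R).
Hypotheses (g0 : 0 < g) (cG : continuous G) (GM : forall x, `|G x| <= M)
  (hG : forall t, a < t <= b -> h t = rlk_weight a g G t).

Lemma RL_integral_rlk_weight m t : 0 < m -> t <= b ->
  RL_integral a m h t = rlconv m (rlk_weight a g G) t.
Proof.
move=> m0 tb; apply: RL_integral_rlconv => //.
- exact: rlk_weight_le.
- by move=> s /andP[sa st]; apply: hG; rewrite sa (le_trans _ tb)// ltW.
- exact: (integrable_rlk_rlk_weight a g0 (continuous_measurable_fun cG) GM).
Qed.

End representation.

Lemma rlk_class_RL a b g m h : 0 < g -> 0 < m -> rlk_class a b g h ->
  rlk_class a b (m + g) (RL_integral a m h).
Proof.
move=> g0 m0 [G [M [cG GM hG]]].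
have [G' [M' [cG' GM' E]]] := rlconv_rlk_weight a g0 m0 cG GM.
exists G', M'; split => // t /andP[ta tb].
by rewrite (RL_integral_rlk_weight g0 cG GM hG m0 tb).
Qed.

Lemma RL_integral_semigroup a b g m n h t : 0 < g -> 0 < m -> 0 < n ->
  rlk_class a b g h -> t <= b ->
  RL_integral a m (RL_integral a n h) t = RL_integral a (m + n) h t.
Proof.
move=> g0 m0 n0 [G [M [cG GM hG]]] tb.
have [G' [M' [cG' GM' E]]] := rlconv_rlk_weight a g0 n0 cG GM.
have hG' s : a < s <= b -> RL_integral a n h s = rlk_weight a (n + g) G' s.
  by move=> /andP[_ sb]; rewrite -E; exact: (RL_integral_rlk_weight g0 cG GM hG n0 sb).
rewrite (RL_integral_rlk_weight (addr_gt0 n0 g0) cG' GM' hG' m0 tb).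
rewrite (RL_integral_rlk_weight g0 cG GM hG (addr_gt0 m0 n0) tb).
rewrite -(rlconv_semigroup a t g0 (continuous_measurable_fun cG) GM m0 n0).
by congr rlconv; apply/funext => s; rewrite E.
Qed.

Lemma RL_integrable_rlk_class a b g m h : 0 < g -> 0 <= m -> rlk_class a b g h ->
  RL_integrable a b m h.
Proof.
move=> g0 m_ge0 [G [M [cG GM hG]]] mn0 t; rewrite in_itv/= => /andP[ta tb].
have m0 : 0 < m by rewrite lt_neqAle eq_sym mn0.
have I := integrable_rlk_rlk_weight a g0 (continuous_measurable_fun cG) GM t m0.
have I1 := integrableZl measurableT (Gamma m) I.
have I2 : mu.-integrable `]a, t[
    (fun s => (Gamma m)%:E * (rlk m (t - s) * rlk_weight a g G s)%:E)%E.
  exact: integrableS I1.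
apply: eq_integrable I2 => // s; rewrite inE/= in_itv/= => /andP[sa st].
rewrite -EFinM; congr EFin; rewrite hG ?sa ?(le_trans (ltW st))//.
by rewrite (rlkE m) ?subr_gt0// mulrA; congr (_ * _); rewrite mulrC divfK// gt_eqF// Gamma_gt0.
Qed.

(** The orders may differ because the two terms of [picard] have orders g and alpha + g. *)
Lemma RL_integralD a b g1 g2 m h1 h2 t : 0 < g1 -> 0 < g2 -> 0 < m ->
  rlk_class a b g1 h1 -> rlk_class a b g2 h2 -> t <= b ->
  RL_integral a m (fun s => h1 s + h2 s) t = RL_integral a m h1 t + RL_integral a m h2 t.
Proof.
move=> g10 g20 m0 [G1 [M1 [cG1 GM1 hG1]]] [G2 [M2 [cG2 GM2 hG2]]] tb.
rewrite (RL_integral_rlk_weight g10 cG1 GM1 hG1 m0 tb).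
rewrite (RL_integral_rlk_weight g20 cG2 GM2 hG2 m0 tb).
have I1 := integrable_rlk_rlk_weight a g10 (continuous_measurable_fun cG1) GM1 t m0.
have I2 := integrable_rlk_rlk_weight a g20 (continuous_measurable_fun cG2) GM2 t m0.
rewrite (@RL_integral_rlconv _ a m t (fun s => rlk_weight a g1 G1 s + rlk_weight a g2 G2 s))//.
- rewrite /rlconv -RintegralD//; apply: eq_Rintegral => s _; exact: mulrDr.
- by move=> s sa; rewrite !rlk_weight_le// addr0.
- by move=> s /andP[sa st]; rewrite hG1 ?hG2// sa (le_trans (ltW st)).
- apply: eq_integrable (integrableD measurableT I1 I2) => // s _.
  by rewrite mulrDr.
Qed.

Lemma RL_integralB_bound a b g m h1 h2 t (K : R) : 0 < g -> 0 < m ->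
  rlk_class a b g h1 -> rlk_class a b g h2 -> t <= b ->
  (forall s, a < s < t -> `|h1 s - h2 s| <= K * rlk g (s - a)) ->
  `|RL_integral a m h1 t - RL_integral a m h2 t| <= K * rlk (m + g) (t - a).
Proof.
move=> g0 m0 [G1 [M1 [cG1 GM1 hG1]]] [G2 [M2 [cG2 GM2 hG2]]] tb hK.
rewrite (RL_integral_rlk_weight g0 cG1 GM1 hG1 m0 tb) (RL_integral_rlk_weight g0 cG2 GM2 hG2 m0 tb).
have mG1 := continuous_measurable_fun cG1.
have mG2 := continuous_measurable_fun cG2.
have I1 := integrable_rlk_rlk_weight a g0 mG1 GM1 t m0.
have I2 := integrable_rlk_rlk_weight a g0 mG2 GM2 t m0.
rewrite [X in `|X|](_ : _ = rlconv m (rlk_weight a g (fun s => G1 s - G2 s)) t); last first.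
  rewrite /rlconv -RintegralB//; apply: eq_Rintegral => s _.
  by rewrite /rlk_weight -!mulrBr.
(* [M1 + M2] is a crude global bound that only secures integrability; the constant of the estimate
   is [K], valid on (a, t). *)
apply: (@rlconv_bound _ a g _ (M1 + M2)) => //.
- exact: measurable_funB.
- by move=> s; apply: le_trans (ler_normB _ _) _; rewrite lerD.
move=> s /andP[sa st]; have := hK s; rewrite sa st => /(_ isT).
rewrite hG1 ?hG2 ?sa ?(le_trans (ltW st))// /rlk_weight -mulrBr normrM mulrC.
have r0 : 0 < rlk g (s - a) by rewrite rlk_gt0// subr_gt0.
by rewrite (gtr0_norm r0) ler_pM2r.
Qed.

Lemma rlk_class_rlk a b g : rlk_class a b g (fun t => rlk g (t - a)).
Proof.
exists (fun=> 1), 1; split; first by move=> t; exact: cvg_cst.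
- by move=> t; rewrite normr1.
- by move=> t _; rewrite /rlk_weight mulr1.
Qed.

Lemma rlk_class_Z a b g c h : rlk_class a b g h -> rlk_class a b g (fun t => c * h t).
Proof.
move=> [G [M [cG GM hG]]]; exists (fun t => c * G t), (`|c| * M); split.
- by move=> t; apply: cvgMr; exact: cG.
- by move=> t; rewrite normrM ler_wpM2l.
- by move=> t tab; rewrite hG// /rlk_weight mulrCA.
Qed.

Lemma RL_integral_rlk a g m c t : 0 < g -> 0 < m ->
  RL_integral a m (fun s => c * rlk g (s - a)) t = c * rlk (m + g) (t - a).
Proof.
move=> g0 m0.
have cc : continuous (fun _ : R => c) by move=> x; exact: cvg_cst.
rewrite (@RL_integral_rlk_weight a t g _ (fun=> c) `|c|)//; last first.
  by move=> s _; rewrite /rlk_weight mulrC.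
have I := @integrable_rlk2 R m g t a m0 g0.
rewrite /rlconv -[rlk (m + g) _]/(fine (_%:E)) -integral_conv_rlk//.
rewrite -/(Rintegral _ _ _) -RintegralZl//; apply: eq_Rintegral => s _.
by rewrite /rlk_weight mulrA mulrC.
Qed.

End weighted_class.

(** * Derivatives relative to the half-open interval *)

Section derivatives.
Context {R : realType}.
Implicit Types (a b g m n w t l : R) (h F u : R -> R).
Local Notation mu := (@lebesgue_measure R).

Lemma addr_cvg_dnbhs t : (fun h : R => h + t) x @[x --> (0:R)^'] --> t^'.
Proof.
move=> A [e /= e0 eA]; exists e => //= x xe x0; apply: eA => /=.
  by move: xe; rewrite /ball_/= sub0r normrN opprD addrCA subrr addr0 normrN.
by rewrite -subr_eq0 addrK.
Qed.

Lemma subr_cvg_dnbhs t : (fun s : R => s - t) x @[x --> t^'] --> (0:R)^'.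
Proof.
move=> A [e /= e0 eA]; exists e => //= x xe xt; apply: eA => /=.
  by rewrite sub0r normrN; move: xe; rewrite /ball_/= distrC.
by rewrite subr_eq0.
Qed.

Lemma is_derive_quotient F t l :
  (F s - F t) / (s - t) @[s --> t^'] --> l -> is_derive t 1 F l.
Proof.
move=> Fl; have Fl0 : h^-1 *: ((F \o shift t) (h *: 1) - F t) @[h --> 0^'] --> l.
  move=> A FA; have H := @addr_cvg_dnbhs t _ (Fl _ FA).
  apply: (@filterS _ _ (dnbhs_filter (0 : R)) _ _ _ H) => h /=.
  by rewrite addrK mulrC /GRing.scale/= mulr1.
apply: DeriveDef; first by apply/cvg_ex; exists l.
by apply/cvg_lim.
Qed.

Lemma quotient_derivable F t : derivable F t 1 ->
  (F s - F t) / (s - t) @[s --> t^'] --> 'D_1 F t.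
Proof.
move=> /cvg_ex[l Fl].
have -> : 'D_1 F t = l by apply/cvg_lim.
move=> A FA; have H := @subr_cvg_dnbhs t _ (Fl _ FA).
apply: (@filterS _ _ (dnbhs_filter t) _ _ _ H) => s /=.
by rewrite /GRing.scale/= mulr1 subrK mulrC.
Qed.

(** Uniqueness of the limit defining [deriv_oc] rests on this. The witness is taken to the left of
    t, which also serves t = b. *)
Lemma within_dnbhs_proper a b t : a < t <= b ->
  ProperFilter (within `]a, b]%classic (t^')).
Proof.
move=> /andP[ta tb]; apply: Build_ProperFilter_ex => P [e /= e0 eP].
pose x := Num.max ((a + t) / 2) (t - e / 2).
have xt : x < t by rewrite /x gt_max; apply/andP; split; lra.
have ax : a < x by rewrite /x lt_max; apply/orP; left; lra.
have xe : t - e / 2 <= x by rewrite /x le_max lexx orbT.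
exists x; apply: eP => /=.
- by rewrite gtr0_norm ?subr_gt0//; lra.
- by rewrite lt_eqF.
- by rewrite in_itv/= ax (le_trans (ltW xt)).
Qed.

Lemma within_dnbhs_interior a b t A : a < t < b ->
  within `]a, b]%classic (t^') A -> (t^') A.
Proof.
move=> /andP[ta tb] wA; near=> s.
have /andP[sa sb] : a < s < b.
  by apply/andP; split; near: s; apply: nbhs_dnbhs; [exact: lt_nbhsr|exact: lt_nbhsl].
suff : `]a, b]%classic s -> A s by apply; rewrite /= in_itv/= sa ltW.
by near: s.
Unshelve. all: by end_near. Qed.

Lemma constant_oc a b u : {within `]a, b], continuous u} ->
  (forall t, a < t < b ->
    (u s - u t) / (s - t) @[s --> within `]a, b] (t^')] --> 0) ->
  {in `]a, b] &, forall s t, u s = u t}.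
Proof.
move=> cu du.
have D t : t \in `]a, b[ -> is_derive t 1 u 0.
  rewrite in_itv/= => tab; apply: is_derive_quotient => A /(du _ tab).
  exact: within_dnbhs_interior.
have D1 t : t \in `]a, b[ -> derivable u t 1 by move=> /D[].
have D2 t : t \in `]a, b[ -> derive1 u t = 0 by move=> /D[_]; rewrite derive1E.
have le0 t : t \in `]a, b[ -> derive1 u t <= 0 by move=> /D2 ->.
have ge0 t : t \in `]a, b[ -> 0 <= derive1 u t by move=> /D2 ->.
have I := ger0_derive1_le_oc D1 ge0 cu.
have J := ler0_derive1_le_oc D1 le0 cu.
have H s t : s \in `]a, b] -> t \in `]a, b] -> s <= t -> u s = u t.
  by move=> sab tab st; apply/eqP; rewrite eq_le I// J.
move=> s t sab tab; case: (leP s t) => [st|/ltW ts]; first exact: H.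
by apply/esym; exact: H.
Qed.

(** The integrand is the exponential density of rate 1, whose total mass is 1. *)
Lemma Gamma1 : Gamma (1 : R) = 1.
Proof.
suff E : (\int[mu]_(t in `]0%R, +oo[) (t `^ (1 - 1) * expR (- t))%:E = 1)%E.
  by rewrite /Gamma /Rintegral E.
rewrite integral_itv_obnd_cbnd; last first.
  apply/measurable_EFinP; apply: measurable_funTS; apply: measurable_funM.
    exact: measurable_powR.
  by apply: measurableT_comp => //; exact: measurableT_comp.
rewrite -(@integral_exponential_pdf R 1)// [RHS](_ : _ =
    \int[mu]_x ((fun t => (t `^ (1 - 1) * expR (- t))%:E) \_ `[0%R, +oo[) x)%E.
  by rewrite integral_mkcond.
apply: eq_integral => x _; rewrite /exponential_pdf !patchE; case: ifPn => // _.
by rewrite subrr powRr0 !mul1r mulN1r.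
Qed.

Lemma rlk1 t : 0 < t -> rlk 1 t = 1.
Proof. by move=> t0; rewrite rlkE// subrr powRr0 Gamma1 divr1. Qed.

Lemma integrable_rlk_weight_itv a g (G : R -> R) (M r : R) : 0 < g -> continuous G ->
  (forall x, `|G x| <= M) -> mu.-integrable `]a, r[ (EFin \o rlk_weight a g G).
Proof.
move=> g0 cG GM.
have I1 := integrable_rlk_rlk_weight a g0 (continuous_measurable_fun cG) GM r ltr01.
have I2 : mu.-integrable `]a, r[ (fun s => (rlk 1 (r - s) * rlk_weight a g G s)%:E).
  exact: integrableS I1.
apply: eq_integrable I2 => // s; rewrite inE/= in_itv/= => /andP[sa su].
by rewrite rlk1 ?mul1r// subr_gt0.
Qed.

Lemma RL_integral1_derive a b g h t : 0 < g -> rlk_class a b g h -> a < t <= b ->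
  (RL_integral a 1 h s - RL_integral a 1 h t) / (s - t)
    @[s --> within `]a, b] (t^')] --> h t.
Proof.
move=> g0 [G [M [cG GM hG]]] /andP[ta tb].
pose phi := rlk_weight a g G.
pose F x := \int[mu]_(s in `]a, x]) phi s.
have RF s : a < s <= b -> RL_integral a 1 h s = F s.
  move=> /andP[sa sb]; rewrite /RL_integral oner_eq0 Gamma1 invr1 mul1r /F.
  have I := @integrable_rlk_weight_itv a g G M s g0 cG GM.
  rewrite -(Rintegral_itv_bndo_bndc I).
  apply: eq_Rintegral => x; rewrite inE/= in_itv/= => /andP[ax xs].
  by rewrite subrr powRr0 mul1r hG// ax (le_trans (ltW xs)).
(* The interval goes past t, so that t is interior to it even when t = b; [phi] makes sense there
   because [G] lives on the whole line. *)
have I : mu.-integrable `]a, t + 1] (EFin \o phi).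
  have I1 := @integrable_rlk_weight_itv a g G M (t + 1 + 1) g0 cG GM.
  apply: integrableS I1 => //; apply: subset_itvl; rewrite bnd_simp; lra.
have tt : t < t + 1 by rewrite ltrDl.
have cphi : {for t, continuous phi} by exact: (@continuous_rlk_weight _ a g G t ta (cG t)).
have at' : (BRight a < BRight t)%O by rewrite bnd_simp.
have [dF F't] := continuous_FTC1 tt I at' cphi.
rewrite hG ?ta// -/phi.
have := quotient_derivable dF; rewrite -derive1E F't => Ft.
have {}Ft : (F s - F t) / (s - t) @[s --> within `]a, b] (t^')] --> phi t.
  move=> A FA; have H := Ft _ FA.
  by apply: (@filterS _ _ (dnbhs_filter t) _ _ _ H) => s As _.
apply: cvg_trans Ft; apply: near_eq_cvg; near=> s.
rewrite !RF ?ta//; near: s; exact: withinT.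
Unshelve. all: by end_near. Qed.

End derivatives.

(** * Fractional integration as a right inverse of differentiation *)

Section inversion.
Context {R : realType}.
Implicit Types (a b g m n w t l : R) (h F u : R -> R).

Lemma RL_integral_ext a m h1 h2 t : a < t ->
  (forall s, a < s <= t -> h1 s = h2 s) -> RL_integral a m h1 t = RL_integral a m h2 t.
Proof.
move=> ta h12; rewrite /RL_integral; case: ifP => _; first by rewrite h12// ta lexx.
congr (_ * _); apply: eq_Rintegral => s; rewrite inE/= in_itv/= => /andP[sa st].
by rewrite h12// sa ltW.
Qed.

Lemma quotient_ext a b F1 F2 t l : a < t <= b ->
  (forall s, a < s <= b -> F1 s = F2 s) ->
  (F1 s - F1 t) / (s - t) @[s --> within `]a, b] (t^')] --> l ->
  (F2 s - F2 t) / (s - t) @[s --> within `]a, b] (t^')] --> l.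
Proof.
move=> tab F12; apply: cvg_trans; apply: near_eq_cvg; near=> s.
have : `]a, b]%classic s by near: s; exact: withinT.
by rewrite /= in_itv/= => sab; rewrite !F12.
Unshelve. all: by end_near. Qed.

Lemma deriv_oc_val a b F t l : a < t <= b ->
  (F s - F t) / (s - t) @[s --> within `]a, b] (t^')] --> l -> deriv_oc a b F t = l.
Proof.
by move=> tab Fl; have PF := within_dnbhs_proper tab; exact: (cvg_lim (@Rhausdorff R) Fl).
Qed.

Lemma deriv_oc_cvg a b F t : derivable_oc a b F -> a < t <= b ->
  (F s - F t) / (s - t) @[s --> within `]a, b] (t^')] --> deriv_oc a b F t.
Proof. by move=> dF tab; apply: dF; rewrite in_itv. Qed.

(** Newton-Leibniz for a derivative that may blow up at a: I^1 u' and u have the same derivative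
    inside the interval, hence differ by a constant, and both tend to 0 at a. *)
Lemma RL_integral1_deriv_oc a b g u t : a < b -> 0 < g ->
  {within `]a, b], continuous u} -> derivable_oc a b u -> u t @[t --> a^'+] --> 0 ->
  rlk_class a b g (deriv_oc a b u) -> a < t <= b ->
  RL_integral a 1 (deriv_oc a b u) t = u t.
Proof.
move=> ab g0 cu du u0 Dw tab.
set D := deriv_oc a b u in Dw *.
pose v s := RL_integral a 1 D s - u s.
have I1 := rlk_class_RL g0 ltr01 Dw.
have g1 : 1 < 1 + g by rewrite ltrDl.
have cv : {within `]a, b], continuous v}.
  by move=> x; apply: cvgB; [exact: (rlk_class_within I1)|exact: cu].
have dv s : a < s < b ->
    (v r - v s) / (r - s) @[r --> within `]a, b] (s^')] --> 0.
  move=> /andP[sa sb]; have sab : a < s <= b by rewrite sa ltW.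
  have PF := within_dnbhs_proper sab.
  rewrite -(subrr (D s)).
  have H := cvgB (RL_integral1_derive g0 Dw sab) (deriv_oc_cvg du sab).
  apply: cvg_trans (H _); apply: near_eq_cvg; apply: nearW => r /=.
  transitivity ((RL_integral a 1 D r - RL_integral a 1 D s) / (r - s) -
    (u r - u s) / (r - s)) => //.
  have aux (x y p q : R) : x - y - (p - q) = x - p - (y - q) by ring.
  by rewrite -mulrBl aux.
have vc := constant_oc cv dv.
have v0 : v s @[s --> a^'+] --> 0.
  by rewrite -(subr0 0); apply: cvgB => //; exact: (rlk_class_cvg0 ab g1 I1).
have vt : v s @[s --> a^'+] --> v t.
  have : (fun=> v t) s @[s --> a^'+] --> v t by exact: cvg_cst.
  apply: cvg_trans; apply: near_eq_cvg; near=> s.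
  by apply: vc; rewrite in_itv//=; near: s; exact: near_right_oc.
by apply/eqP; rewrite -subr_eq0; apply/eqP; apply: (cvg_unique _ vt v0).
Unshelve. all: by end_near. Qed.

(** In general I^n D^n h differs from h by a multiple of (t - a)^(n - 1). The condition n < g
    removes that term: I^(1 - n) h then has order 1 - n + g > 1 and tends to 0 at a. *)
Lemma RL_integral_RL_derivative a b g n h t : a < b -> 0 <= n < 1 -> n < g ->
  rlk_class a b g h -> derivable_oc a b (RL_integral a (1 - n) h) ->
  rlk_class a b g (RL_derivative a b n h) -> a < t <= b ->
  RL_integral a n (RL_derivative a b n h) t = h t.
Proof.
move=> ab /andP[n_ge0 n1] ng hw dh Dw tab.
have g0 : 0 < g by exact: le_lt_trans ng.
have n1' : 0 < 1 - n by rewrite subr_gt0.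
have uw := rlk_class_RL g0 n1' hw.
have u1 : 1 < 1 - n + g by lra.
have uE s : a < s <= b ->
    RL_integral a 1 (RL_derivative a b n h) s = RL_integral a (1 - n) h s.
  apply: (RL_integral1_deriv_oc ab g0 (rlk_class_within uw)) => //.
  exact: (rlk_class_cvg0 ab u1 uw).
(* At order 0 the outer integral is the identity by definition, and what remains is the derivative
   of I^1 h. *)
have [n0|n0] := eqVneq n 0.
  rewrite n0 /RL_integral eqxx; apply: deriv_oc_val => //.
  by rewrite subr0; exact: (RL_integral1_derive g0 hw tab).
have n_gt0 : 0 < n by rewrite lt_neqAle eq_sym n0.
(* [I^1 I^n D^n h = I^n I^1 D^n h = I^n I^(1 - n) h = I^1 h], then differentiate. *)
have E s : a < s <= b ->
    RL_integral a 1 (RL_integral a n (RL_derivative a b n h)) s = RL_integral a 1 h s.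
  move=> sab; have /andP[sa sb] := sab.
  rewrite (RL_integral_semigroup g0 ltr01 n_gt0 Dw sb) addrC.
  rewrite -(RL_integral_semigroup g0 n_gt0 ltr01 Dw sb).
  have -> : RL_integral a 1 h s = RL_integral a (n + (1 - n)) h s by congr RL_integral; ring.
  rewrite -(RL_integral_semigroup g0 n_gt0 n1' hw sb).
  by apply: RL_integral_ext => // r /andP[ra rs]; rewrite uE// ra (le_trans rs).
have ng0 : 0 < n + g by exact: addr_gt0.
have H1 := RL_integral1_derive ng0 (rlk_class_RL g0 n_gt0 Dw) tab.
have H2 := RL_integral1_derive g0 hw tab.
rewrite -(deriv_oc_val tab H2); apply/esym.
apply: deriv_oc_val => //; exact: quotient_ext H1.
Qed.

End inversion.

(** * Banach iteration in the weighted class *)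

Section fixed_point.
Context {R : realType}.
Implicit Types (a b g t q K : R).

(** The rate depends on [K] and [q] alone, so applying this pointwise to a sequence of functions
    gives uniform convergence. *)
Lemma geometric_limit (x : nat -> R) K q : 0 <= q < 1 ->
  (forall n, `|x n.+1 - x n| <= K * q ^+ n) ->
  exists l, forall n, `|l - x n| <= K / (1 - q) * q ^+ n.
Proof.
move=> /andP[q0 q1] xK; have q1' : 0 < 1 - q by rewrite subr_gt0.
(* [x n - e n] increases, [x n + e n] decreases, and the limit is the
   supremum of the former. *)
pose e n := K / (1 - q) * q ^+ n.
have eS n : e n - e n.+1 = K * q ^+ n.
  by rewrite /e exprS; field; rewrite gt_eqF.
have K0 : 0 <= K by have := xK 0; rewrite expr0 mulr1; exact: le_trans.
have e0 n : 0 <= e n by rewrite mulr_ge0 ?exprn_ge0// divr_ge0// ltW.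
have lo : {homo (fun n => x n - e n) : m n / (m <= n)%N >-> m <= n}.
  apply: homo_leq; [exact: lexx|by move=> ? ? ?; exact: le_trans|move=> n].
  by have := xK n; rewrite -eS ler_norml => /andP[+ _]; lra.
have hi : {homo (fun n => x n + e n) : m n / (m <= n)%N >-> n <= m}.
  apply: homo_leq; [exact: lexx|by move=> ? ? ? h1 h2; exact: le_trans h2 h1|move=> n].
  by have := xK n; rewrite -eS ler_norml => /andP[_]; lra.
have lohi m n : x m - e m <= x n + e n.
  have := lo _ _ (leq_maxl m n); have := hi _ _ (leq_maxr m n).
  by have := e0 (maxn m n); lra.
pose S := range (fun n => x n - e n).
have S0 : S !=set0 by exists (x 0 - e 0); exists 0%N.
exists (sup S) => n; rewrite -/(e n) ler_distl; apply/andP; split.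
  apply: sup_upper_bound; last by exists n.
  by split => //; exists (x 0 + e 0) => _ [m _ <-]; exact: lohi.
by apply: ge_sup => // _ [m _ <-]; exact: lohi.
Qed.

Lemma le_geometric_eq0 (x C q : R) : 0 <= q < 1 -> 0 <= x ->
  (forall n, x <= C * q ^+ n) -> x = 0.
Proof.
move=> /andP[q0 q1] x0 xC; apply/eqP; rewrite eq_le x0 andbT.
have H : (C * q ^+ n) @[n --> \oo] --> C * 0.
  by apply: cvgMr; apply: cvg_expr; rewrite ger0_norm.
rewrite mulr0 in H; rewrite -(cvg_lim (@Rhausdorff R) H).
by apply: limr_ge; [apply/cvg_ex; eexists; exact: H|exact: nearW].
Qed.

(* The metric projection onto the segment from a to b. *)
Definition clamp a b t : R := (a + b) / 2 + (`|t - a| - `|t - b|) / 2.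

Lemma clamp_id a b t : a <= t <= b -> clamp a b t = t.
Proof.
move=> /andP[ta tb]; rewrite /clamp ger0_norm ?subr_ge0// ler0_norm ?subr_le0//.
by field.
Qed.

Lemma clamp_itv a b t : a <= b -> a <= clamp a b t <= b.
Proof.
move=> ab; rewrite /clamp.
by case: (lerP a t); case: (lerP b t) => *; apply/andP; split; lra.
Qed.

Lemma continuous_clamp a b : continuous (clamp a b).
Proof.
move=> t; apply: cvgD; first exact: cvg_cst.
apply: cvgMl; apply: cvgB; apply: cvg_norm;
  by apply: cvgB; [exact: cvg_id|exact: cvg_cst].
Qed.

(** The bounds by [K * rlk g (t - a)] express the weighted norm without a supremum. The iterates
    start from 0, and the limit is constructed as a continuous bounded factor [H], since membership
    in the class means having such a factor. *)
Lemma rlk_class_fixed_point a b g (T : (R -> R) -> R -> R) q : a < b -> 0 < g ->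
  0 <= q < 1 -> (forall z, rlk_class a b g z -> rlk_class a b g (T z)) ->
  (forall z1 z2 K, rlk_class a b g z1 -> rlk_class a b g z2 ->
    (forall t, a < t <= b -> `|z1 t - z2 t| <= K * rlk g (t - a)) ->
    forall t, a < t <= b -> `|T z1 t - T z2 t| <= q * K * rlk g (t - a)) ->
  exists2 z, rlk_class a b g z & forall t, a < t <= b -> T z t = z t.
Proof.
move=> ab g0 q01 Tw Tq; have /andP[q0 q1] := q01.
have r0 t : a < t <= b -> 0 < rlk g (t - a).
  by move=> /andP[ta _]; rewrite rlk_gt0// subr_gt0.
pose zn n := iter n T (fun=> 0).
have znw n : rlk_class a b g (zn n).
  elim: n => [|n IH]; last exact: Tw.
  exists (fun=> 0), 0; split => [t|t|t _]; [exact: cvg_cst|by rewrite normr0|].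
  by rewrite /rlk_weight mulr0.
have /choice[G /choice[M GM]] := znw.
have cG n : continuous (G n) by case: (GM n).
have zG n t : a < t <= b -> zn n t = rlk_weight a g (G n) t by case: (GM n) => _ _; exact.
pose K := M 1%N + M 0%N.
have zK n t : a < t <= b -> `|zn n.+1 t - zn n t| <= K * q ^+ n * rlk g (t - a).
  elim: n t => [|n IH] t tab; last first.
    by rewrite exprS (mulrCA K); exact: (Tq (zn n.+1) (zn n) _ (znw _) (znw _) IH).
  rewrite expr0 mulr1 !zG// /rlk_weight -mulrBr normrM mulrC (gtr0_norm (r0 _ tab)).
  rewrite (ler_pM2r (r0 _ tab)); apply: le_trans (ler_normB _ _) _.
  by case: (GM 0) => _ h0 _; case: (GM 1) => _ h1 _; exact: lerD.
have GK n t : a < t <= b -> `|G n.+1 t - G n t| <= K * q ^+ n.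
  move=> tab; have := zK n t tab; rewrite !zG// /rlk_weight -mulrBr normrM mulrC.
  by rewrite (gtr0_norm (r0 _ tab)) (ler_pM2r (r0 _ tab)).
(* The iterates carry no information at a, where the kernel is 0; the bound passes to a by
   continuity of the factors. *)
have GKa n : `|G n.+1 a - G n a| <= K * q ^+ n.
  have H : `|G n.+1 t - G n t| @[t --> a^'+] --> `|G n.+1 a - G n a|.
    apply: cvg_norm; apply: cvgB; apply: cvg_at_right_filter; exact: cG.
  rewrite -(cvg_lim (@Rhausdorff R) H); apply: limr_le.
    by apply/cvg_ex; eexists; exact: H.
  by near=> t; apply: GK; near: t; exact: near_right_oc.
(* Outside [a, b] the chosen factors are unrelated to one another. Composing with [clamp] discards
   those values and gives a geometric bound uniform on the line. *)
have GKc n t : `|G n.+1 (clamp a b t) - G n (clamp a b t)| <= K * q ^+ n.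
  have := @clamp_itv a b t (ltW ab); rewrite le_eqVlt => /andP[/orP[/eqP <-|h1] h2].
    exact: GKa.
  by apply: GK; rewrite h1.
have /choice[H HG] := fun t => geometric_limit (x := fun n => G n (clamp a b t)) q01 (GKc ^~ t).
pose E n := K / (1 - q) * q ^+ n.
have E0 : E n @[n --> \oo] --> 0.
  rewrite -(mulr0 (K / (1 - q))); apply: cvgMr; apply: cvg_expr.
  by rewrite ger0_norm.
have cH : continuous H.
  move=> t; apply/cvgrPdist_lt => e e0.
  have e3 : 0 < e / 3 by rewrite divr_gt0.
  have [n En] : exists n, E n < e / 3.
    move/cvgrPdist_lt : E0 => /(_ _ e3)[n _ /(_ n (leqnn n))].
    by rewrite sub0r normrN => En; exists n; exact: le_lt_trans (ler_norm _) En.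
  have cGn : G n (clamp a b x) @[x --> t] --> G n (clamp a b t).
    apply: (@continuous_comp _ _ _ (clamp a b) (G n)); last exact: cG.
    exact: continuous_clamp.
  near=> x.
  have h1 : `|G n (clamp a b t) - G n (clamp a b x)| < e / 3.
    by near: x; move/cvgrPdist_lt : cGn; exact.
  have := HG t n; have := HG x n; rewrite -/(E n) => h2 h3.
  rewrite (_ : H t - H x = (H t - G n (clamp a b t)) +
    ((G n (clamp a b t) - G n (clamp a b x)) - (H x - G n (clamp a b x)))); last by ring.
  apply: le_lt_trans (ler_normD _ _) _.
  have := ler_normB (G n (clamp a b t) - G n (clamp a b x)) (H x - G n (clamp a b x)).
  by lra.
have HM t : `|H t| <= E 0 + M 0.
  have := HG t 0%N; rewrite -/(E 0) => h; rewrite -(subrK (G 0 (clamp a b t)) (H t)).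
  apply: le_trans (ler_normD _ _) _; apply: lerD => //.
  by case: (GM 0).
pose z := rlk_weight a g H.
have zw : rlk_class a b g z by exists H, (E 0 + M 0%N); split.
have zE n t : a < t <= b -> `|z t - zn n t| <= E n * rlk g (t - a).
  move=> tab; rewrite zG// /z /rlk_weight -mulrBr normrM mulrC (gtr0_norm (r0 _ tab)).
  rewrite (ler_pM2r (r0 _ tab)); have := HG t n; rewrite clamp_id//.
  by case/andP: tab => /ltW -> ->.
exists z => // t tab; apply/eqP; rewrite -subr_eq0 -normr_eq0; apply/eqP.
(* Inserting [T (zn n) = zn n.+1] bounds the defect by q E n + E (n + 1), which is 2 q K / (1 - q)
   q^n, times the kernel. *)
apply: (@le_geometric_eq0 _ (2 * q * (K / (1 - q)) * rlk g (t - a)) q) => // n.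
have h1 := Tq _ _ _ zw (znw n) (zE n) t tab.
have h2 := zE n.+1 t tab.
rewrite (_ : T z t - z t = (T z t - T (zn n) t) - (z t - zn n.+1 t)); last first.
  by rewrite /zn /=; ring.
apply: le_trans (ler_normB _ _) _; apply: le_trans (lerD h1 h2) _.
by rewrite /E exprS le_eqVlt; apply/orP; left; apply/eqP; ring.
Unshelve. all: by end_near. Qed.

End fixed_point.

(** * From the weighted class to the spaces of the statement *)

Section spaces.
Context {R : realType}.
Implicit Types (a b g m n w t l : R) (h F u : R -> R).

Lemma rlk_classD a b g h1 h2 : rlk_class a b g h1 -> rlk_class a b g h2 ->
  rlk_class a b g (fun t => h1 t + h2 t).
Proof.
move=> [G1 [M1 [cG1 GM1 hG1]]] [G2 [M2 [cG2 GM2 hG2]]].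
exists (fun t => G1 t + G2 t), (M1 + M2); split.
- by move=> t; apply: cvgD; [exact: cG1|exact: cG2].
- by move=> t; apply: le_trans (ler_normD _ _) _; exact: lerD.
- by move=> t tab; rewrite hG1// hG2// /rlk_weight mulrDr.
Qed.

Lemma rlk_class_ext a b g h1 h2 : (forall t, a < t <= b -> h1 t = h2 t) ->
  rlk_class a b g h1 -> rlk_class a b g h2.
Proof.
move=> h12 [G [M [cG GM hG]]]; exists G, M; split => // t tab.
by rewrite -h12// hG.
Qed.

Lemma rlk_class_wCE a b g h : a < b -> 0 < g -> wC a b (1 - g) h <-> rlk_class a b g h.
Proof.
move=> ab g0; split; last by apply: rlk_class_wC => //; lra.
move=> /wC_rlk_class; rewrite (_ : 1 - (1 - g) = g); last by ring.
by apply => //; lra.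
Qed.

Lemma rlk_class_RL_ge0 a b g m h : a < b -> 0 < g -> 0 <= m ->
  rlk_class a b g h -> rlk_class a b g (RL_integral a m h).
Proof.
move=> ab g0; rewrite le_eqVlt => /orP[/eqP <- hw|m0 hw].
  by apply: rlk_class_ext hw => t _; rewrite /RL_integral eqxx.
apply/rlk_class_wCE => //; apply: (rlk_class_wC ab _ (rlk_class_RL g0 m0 hw)); lra.
Qed.

Lemma derivable_oc_ext a b F1 F2 : (forall s, a < s <= b -> F1 s = F2 s) ->
  derivable_oc a b F1 -> derivable_oc a b F2.
Proof.
move=> F12 dF t; rewrite in_itv/= => tab; apply/cvg_ex; exists (deriv_oc a b F1 t).
exact: (quotient_ext tab F12 (deriv_oc_cvg dF tab)).
Qed.

Lemma deriv_oc_ext a b F1 F2 t : (forall s, a < s <= b -> F1 s = F2 s) ->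
  derivable_oc a b F1 -> a < t <= b -> deriv_oc a b F2 t = deriv_oc a b F1 t.
Proof.
move=> F12 dF tab; apply: deriv_oc_val => //.
exact: (quotient_ext tab F12 (deriv_oc_cvg dF tab)).
Qed.

Lemma quotient_addl F t l x (D : set R) :
  (F s - F t) / (s - t) @[s --> within D (t^')] --> l ->
  ((x + F s) - (x + F t)) / (s - t) @[s --> within D (t^')] --> l.
Proof.
apply: cvg_trans; apply: near_eq_cvg; apply: nearW => s /=.
by congr (_ / _); ring.
Qed.

Lemma wC_RL_sub_wC_Hilfer a b alpha beta g : a < b -> 0 < alpha < 1 ->
  0 <= beta <= 1 -> g = alpha + beta - alpha * beta ->
  wC_RL a b (1 - g) g `<=` wC_Hilfer a b (1 - g) alpha beta.
Proof.
move=> ab /andP[al0 al1] /andP[be0 be1] gE h [hC dh Dh].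
have n0 : 0 <= beta * (1 - alpha) by rewrite mulr_ge0// subr_ge0 ltW.
have g0 : 0 < g by rewrite gE; lra.
have E : (1 - beta) * (1 - alpha) = 1 - g by rewrite gE; ring.
rewrite /wC_Hilfer /Hilfer_derivative /= E; split => //.
- by apply: (RL_integrable_rlk_class g0 n0); apply/rlk_class_wCE.
- by apply/rlk_class_wCE => //; apply: rlk_class_RL_ge0 => //; exact/rlk_class_wCE.
Qed.

End spaces.

(** * The integral operator: its contraction constant and its fixed points *)

(** The ratio of the two kernels is a constant times x^m, which increases with x. With m = alpha and
    y = b - a this yields the second summand of W. *)
Lemma rlkD_le (R : realType) (m g x y : R) : 0 < m -> 0 < g -> 0 < x -> x <= y ->
  rlk (m + g) x <= y `^ m * (Gamma g / Gamma (g + m)) * rlk g x.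
Proof.
move=> m0 g0 x0 xy; rewrite (rlkE (m + g) x0) (rlkE g x0) (addrC m g).
have Gg := Gamma_gt0 g0; have Ggm := Gamma_gt0 (addr_gt0 g0 m0).
have -> : x `^ (g + m - 1) = x `^ m * x `^ (g - 1).
  by rewrite -[RHS]powRD ?(gt_eqF x0) ?implybT//; congr (_ `^ _); ring.
have p : x `^ m <= y `^ m.
  by apply: (ge0_ler_powR (ltW m0)); rewrite ?nnegrE // ltW// (lt_le_trans x0).
have aux (u v r s : R) : r != 0 -> s != 0 -> u * (r / s) * (v / r) = u * (v / s).
  by move=> r0 s0; field; rewrite r0 s0.
rewrite (aux _ _ _ _ (lt0r_neq0 Gg) (lt0r_neq0 Ggm)).
rewrite -mulrA; apply: ler_wpM2r p.
by apply: divr_ge0; [exact: powR_ge0|exact: ltW].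
Qed.

(** Here q is |d / (c + d)|, p is (b - a)^alpha, r, s, v are Gamma at g, g + alpha, alpha + 1, l and
    k are L and K, and x is the kernel value. *)
Lemma contraction_constant_eq (F : fieldType) (q p r s v k x l : F) :
  r != 0 -> s != 0 -> v != 0 ->
  q * (l * k * (p / v)) * x + l * k * (p * (r / s) * x) =
  (q * (1 / r) + v / s) * (r * p / v) * l * k * x.
Proof. by move=> r0 s0 v0; field; rewrite r0 s0 v0. Qed.

Section picard_operator.
Context {R : realType}.
Variables (a b alpha beta g c d ek L : R) (f : R -> R -> R).
Hypotheses (ab : a < b) (halpha : 0 < alpha < 1) (hbeta : 0 <= beta <= 1)
  (gE : g = alpha + beta - alpha * beta) (hcd : c + d != 0)
  (hf : forall z, wC a b (1 - g) z ->
    wC_RL a b (1 - g) (beta * (1 - alpha)) (fun t => f t (z t)))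
  (hL : 0 < L)
  (hLip : forall t z w : R, a < t <= b -> `|f t z - f t w| <= L * `|z - w|).

Local Notation nem z := (fun t => f t (z t)).

(** The solution K of c K + d (K + u b) = ek, where u = I^(1 - g + alpha) (f (., z)): I^(1 - g) z is
    K + u, with limit K at a and K + u b at b. *)
Definition picard_coef (z : R -> R) : R :=
  ek / (c + d) - d / (c + d) * RL_integral a (1 - g + alpha) (nem z) b.

Definition picard (z : R -> R) (t : R) : R :=
  picard_coef z * rlk g (t - a) + RL_integral a alpha (nem z) t.

Let al0 : 0 < alpha. Proof. by case/andP: halpha. Qed.
Let al1 : alpha < 1. Proof. by case/andP: halpha. Qed.
Let n0 : 0 <= beta * (1 - alpha).
Proof. by case/andP: hbeta => b0 _; rewrite mulr_ge0// subr_ge0 ltW. Qed.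
Let nE : beta * (1 - alpha) = g - alpha. Proof. by rewrite gE; ring. Qed.
Let n1 : beta * (1 - alpha) < 1.
Proof. by case/andP: hbeta => b0 b1; have := al0; nra. Qed.
Let g0 : 0 < g. Proof. by have := n0; rewrite nE; have := al0; lra. Qed.
Let mE : 1 - g + alpha = 1 - beta * (1 - alpha). Proof. by rewrite nE; ring. Qed.
Let m0 : 0 < 1 - g + alpha. Proof. by rewrite mE subr_gt0. Qed.
Let g1 : g <= 1.
Proof. by case/andP: hbeta => b0 b1; have := al1; rewrite gE; nra. Qed.

Lemma rlk_class_nem z : rlk_class a b g z -> rlk_class a b g (nem z).
Proof. by move=> zw; apply/rlk_class_wCE => //; case: (hf (proj2 (rlk_class_wCE _ ab g0) zw)). Qed.

Lemma rlk_class_picard z : rlk_class a b g z -> rlk_class a b g (picard z).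
Proof.
move=> zw; apply: rlk_classD; first by apply: rlk_class_Z; exact: rlk_class_rlk.
by apply: rlk_class_RL_ge0 => //; [exact: ltW|exact: rlk_class_nem].
Qed.

Lemma picard_contraction z1 z2 (K : R) : rlk_class a b g z1 -> rlk_class a b g z2 ->
  (forall t, a < t <= b -> `|z1 t - z2 t| <= K * rlk g (t - a)) ->
  forall t, a < t <= b -> `|picard z1 t - picard z2 t| <=
    ((`|d / (c + d)| * (1 / Gamma g) + Gamma (alpha + 1) / Gamma (g + alpha))
      * (Gamma g * (b - a) `^ alpha / Gamma (alpha + 1)) * L)
    * K * rlk g (t - a).
Proof.
move=> z1w z2w zK t /andP[ta tb].
have w1 := rlk_class_nem z1w; have w2 := rlk_class_nem z2w.
have LK s : a < s <= b -> `|nem z1 s - nem z2 s| <= L * K * rlk g (s - a).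
  move=> sab; apply: le_trans (hLip _ _ sab) _.
  by rewrite -mulrA ler_wpM2l ?zK// ltW.
have ba0 : 0 < b - a by rewrite subr_gt0.
have ta0 : 0 < t - a by rewrite subr_gt0.
have K0 : 0 <= K.
  have := zK t; rewrite ta tb => /(_ isT) h.
  by rewrite -(pmulr_lge0 _ (rlk_gt0 g0 ta0)) (le_trans _ h).
have B1 : `|RL_integral a alpha (nem z1) t - RL_integral a alpha (nem z2) t| <=
    L * K * rlk (alpha + g) (t - a).
  apply: (RL_integralB_bound g0 al0 w1 w2 tb) => s /andP[sa st].
  by apply: LK; rewrite sa (le_trans (ltW st)).
have B2 : `|RL_integral a (1 - g + alpha) (nem z1) b -
     RL_integral a (1 - g + alpha) (nem z2) b| <=
    L * K * rlk (1 - g + alpha + g) (b - a).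
  apply: (RL_integralB_bound g0 m0 w1 w2 (lexx b)) => s /andP[sa st].
  by apply: LK; rewrite sa ltW.
have Gg := Gamma_gt0 g0; have Ga1 := Gamma_gt0 (addr_gt0 al0 (ltr01 : 0 < 1 :> R)).
have Gga := Gamma_gt0 (addr_gt0 g0 al0).
have r0 := rlk_gt0 g0 ta0.
(* The orders add up to alpha + 1 whatever g is, which is the origin of Gamma (alpha + 1) in W. *)
have E1 : rlk (1 - g + alpha + g) (b - a) = (b - a) `^ alpha / Gamma (alpha + 1).
  have -> : 1 - g + alpha + g = alpha + 1 by ring.
  by rewrite (rlkE _ ba0) addrK.
have E2 : rlk (alpha + g) (t - a) <=
    (b - a) `^ alpha * (Gamma g / Gamma (g + alpha)) * rlk g (t - a).
  exact: rlkD_le al0 g0 ta0 (lerB tb (lexx a)).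
set A1 := RL_integral a (1 - g + alpha) (nem z1) b in B2.
set A2 := RL_integral a (1 - g + alpha) (nem z2) b in B2.
set C1 := RL_integral a alpha (nem z1) t in B1.
set C2 := RL_integral a alpha (nem z2) t in B1.
have -> : picard z1 t - picard z2 t =
    - (d / (c + d)) * (A1 - A2) * rlk g (t - a) + (C1 - C2).
  rewrite /picard /picard_coef -/A1 -/A2 -/C1 -/C2.
  by move: A1 A2 C1 C2 (d / (c + d)) (ek / (c + d)) (rlk _ _) {B1 B2} => *; ring.
apply: le_trans (ler_normD _ _) _.
rewrite (normrM _ (rlk _ _)) (normrM _ (A1 - A2)) normrN (gtr0_norm r0).
rewrite E1 in B2.
have LK0 : 0 <= L * K by rewrite mulr_ge0// ltW.
have hX := ler_wpM2r (ltW r0) (ler_wpM2l (normr_ge0 (d / (c + d))) B2).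
have hY := le_trans B1 (ler_wpM2l LK0 E2).
apply: (le_trans (lerD hX hY)).
rewrite le_eqVlt; apply/orP; left; apply/eqP.
exact: (contraction_constant_eq _ _ _ _ _ (lt0r_neq0 Gg) (lt0r_neq0 Gga) (lt0r_neq0 Ga1)).
Qed.

Lemma picard_fixed_point_solution z : d != 0 -> rlk_class a b g z ->
  (forall t, a < t <= b -> picard z t = z t) ->
  [/\ wC_RL a b (1 - g) g z,
      forall t, a < t <= b -> Hilfer_derivative a b alpha beta z t = f t (z t) &
      RL_boundary_condition a b g c d ek z].
Proof.
move=> d0 zw zfix; have Fw := rlk_class_nem zw.
have [_ dF DF] := hf (proj2 (rlk_class_wCE _ ab g0) zw).
pose u := RL_integral a (1 - g + alpha) (nem z).
have uw : rlk_class a b (1 - g + alpha + g) u by exact: rlk_class_RL.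
have IE t : a < t <= b -> picard_coef z + u t = RL_integral a (1 - g) z t.
  move=> /andP[ta tb].
  have rw : rlk_class a b g (fun t => picard_coef z * rlk g (t - a)).
    by apply: rlk_class_Z; exact: rlk_class_rlk.
  have Iw := rlk_class_RL g0 al0 Fw.
  rewrite (@RL_integral_ext _ a (1 - g) z (picard z) t ta); last first.
    by move=> s /andP[sa st]; rewrite zfix// sa (le_trans st).
  (* For g = 1 the operator I^(1 - g) is the identity by definition and the kernel of order g is
     already 1; otherwise I^(1 - g) maps it to the kernel of order 1, which is 1. *)
  have [g_1|g_1] := eqVneq g 1.
    rewrite [RHS]/RL_integral g_1 subrr eqxx /picard /u g_1 subrr add0r.
    by rewrite rlk1 ?subr_gt0// mulr1.
  have g1' : 0 < 1 - g by rewrite subr_gt0 lt_neqAle g_1.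
  rewrite /picard (RL_integralD g0 (addr_gt0 al0 g0) g1' rw Iw tb).
  rewrite RL_integral_rlk// subrK rlk1 ?subr_gt0// mulr1.
  by rewrite (RL_integral_semigroup g0 g1' al0 Fw tb).
(* Since 1 - g + alpha = 1 - beta (1 - alpha), [u] is precisely the integral whose differentiability
   [hf] provides. *)
have du : derivable_oc a b u by rewrite /u mE.
have dcu : derivable_oc a b (fun t => picard_coef z + u t).
  move=> t; rewrite in_itv/= => tab; apply/cvg_ex; exists (deriv_oc a b u t).
  exact: (quotient_addl (picard_coef z) (deriv_oc_cvg du tab)).
have DE t : a < t <= b ->
    deriv_oc a b (RL_integral a (1 - g) z) t = RL_derivative a b (beta * (1 - alpha)) (nem z) t.
  move=> tab; rewrite (deriv_oc_ext IE dcu tab).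
  rewrite /RL_derivative -mE -/u; apply: deriv_oc_val => //.
  exact: (quotient_addl (picard_coef z) (deriv_oc_cvg du tab)).
have DFw : rlk_class a b g (RL_derivative a b (beta * (1 - alpha)) (nem z)) by exact/rlk_class_wCE.
split.
- split; first exact/rlk_class_wCE.
    exact: derivable_oc_ext IE dcu.
  apply/rlk_class_wCE => //; apply: rlk_class_ext DFw => t tab.
  exact/esym/DE.
- move=> t tab; have /andP[ta tb] := tab.
  rewrite /Hilfer_derivative (_ : (1 - beta) * (1 - alpha) = 1 - g); last by rewrite gE; ring.
  rewrite (@RL_integral_ext _ a _ _ (RL_derivative a b (beta * (1 - alpha)) (nem z)) t ta).
    apply: (RL_integral_RL_derivative (g := g) ab _ _ Fw dF DFw tab).
      by rewrite n0.
    by rewrite nE; have := al0; lra.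
  by move=> s /andP[sa st]; rewrite DE// sa (le_trans st).
(* [u] has order alpha + 1 > 1, so it tends to 0 at a and the left boundary value is the coefficient
   alone. *)
- have u1 : 1 < 1 - g + alpha + g by have := al0; lra.
  exists (picard_coef z), (picard_coef z + u b); split.
  + have : picard_coef z + u t @[t --> a^'+] --> picard_coef z + 0.
      by apply: cvgD; [exact: cvg_cst|exact: rlk_class_cvg0 uw].
    rewrite addr0; apply: cvg_trans; apply: near_eq_cvg; near=> t.
    by rewrite IE//; near: t; exact: near_right_oc.
  + have : picard_coef z + u t @[t --> b^'-] --> picard_coef z + u b.
      by apply: cvgD; [exact: cvg_cst|exact: rlk_class_cvg_left uw].
    apply: cvg_trans; apply: near_eq_cvg; near=> t; rewrite IE//.
    by apply/andP; split; near: t; [exact: nbhs_left_gt|exact: nbhs_left_le].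
  + by rewrite /picard_coef -/u; field.
Unshelve. all: by end_near. Qed.

End picard_operator.

Theorem theorem3p4 (R : realType) (a b alpha beta gamma c d ek L : R)
    (f : R -> R -> R)
    (hab : a < b)
    (halpha : 0 < alpha < 1)
    (hbeta : 0 <= beta <= 1)
    (hgamma : gamma = alpha + beta - alpha * beta)
    (hd : d != 0)
    (hcd : c + d != 0)
    (hf : forall z : R -> R, wC a b (1 - gamma) z ->
      wC_RL a b (1 - gamma) (beta * (1 - alpha)) (fun t => f t (z t)))
    (hL : 0 < L)
    (hLip : forall t z w : R, t \in `]a, b] ->
      `|f t z - f t w| <= L * `|z - w|)
    (hW : (`|1 / (1 + c / d)| * (1 / Gamma gamma)
           + Gamma (alpha + 1) / Gamma (gamma + alpha))
          * (Gamma gamma * (b - a) `^ alpha / Gamma (alpha + 1)) * L < 1)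
    (hW' : `|1 / (1 + c / d)| * ((b - a) `^ alpha / Gamma gamma)
          * (Gamma gamma / Gamma (alpha + 1)) * L < 1) :
  wC_RL a b (1 - gamma) gamma `<=` wC_Hilfer a b (1 - gamma) alpha beta /\
  exists z : R -> R,
    [/\ wC_RL a b (1 - gamma) gamma z,
        forall t, t \in `]a, b] ->
          Hilfer_derivative a b alpha beta z t = f t (z t) &
        RL_boundary_condition a b gamma c d ek z].
Proof.
split; first exact: wC_RL_sub_wC_Hilfer.
have /andP[al0 al1] := halpha; have /andP[be0 be1] := hbeta.
have g0 : 0 < gamma.
  have : 0 <= beta * (1 - alpha) by rewrite mulr_ge0// subr_ge0 ltW.
  by rewrite hgamma; lra.
have Lip t z w : a < t <= b -> `|f t z - f t w| <= L * `|z - w|.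
  by move=> tab; apply: hLip; rewrite in_itv.
(* This identifies the factor in the hypothesis with the weight of the boundary integral in
   [picard_coef], so [W] is literally the contraction ratio. *)
have qE : 1 / (1 + c / d) = d / (c + d).
  have -> : 1 + c / d = (c + d) / d by field.
  by rewrite div1r invf_div.
rewrite qE in hW.
set W := _ * L in hW.
have W0 : 0 <= W.
  rewrite /W; apply: mulr_ge0; last exact: ltW.
  by rewrite mulr_ge0 ?addr_ge0 ?mulr_ge0 ?invr_ge0 ?powR_ge0// ltW// Gamma_gt0// addr_gt0.
have W01 : 0 <= W < 1 by rewrite W0.
have [z zw zfix] := rlk_class_fixed_point hab g0 W01
  (rlk_class_picard c d ek hab halpha hbeta hgamma hf)
  (picard_contraction c d ek hab halpha hbeta hgamma hf hL Lip).
have [z1 z2 z3] :=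
  picard_fixed_point_solution hab halpha hbeta hgamma hcd hf hd zw zfix.
by exists z; split => // t; rewrite in_itv; exact: z2.
Qed.
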